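(* Let $S\subseteq T$ be nonempty connected subquivers of a finite acyclic quiver $Q$ which have the same skeleton, and write $\mathcal{A}=T_1\setminus S_1$ for the set of arrows of $T$ which are not in $S$. Let $\mu$ be the Möbius function of the category $\mathrm{PIE}$ of $Q$. The following formulas hold (each one whenever the objects appearing in it are defined). (i) If $P_S\neq E_S\neq I_S$ (that is, $E_S$ is equal neither to $P_S$ nor to $I_S$), then \[ \mu(E_S,P_T)=0,\quad \mu(E_S,E_T)=(-1)^{\#\mathcal{A}},\quad \mu(P_S,P_T)=(-1)^{\#\mathcal{A}},\quad \mu(P_S,E_T)=(-1)^{\#\mathcal{A}+1},\quad \mu(P_S,I_T)=0 . \] (ii) If $X=P_S=E_S\neq I_S$, then \[ \mu(X,E_T)=0,\quad \mu(X,P_T)=(-1)^{\#\mathcal{A}},\quad \mu(X,I_T)=0 . \] (iii) If $Y=P_S=E_S=I_S$, then \[ \mu(Y,E_T)=(-1)^{\#\mathcal{A}+1},\quad \mu(Y,P_T)=(-1)^{\#\mathcal{A}} . \] Moreover, the dual formulas, obtained by interchanging $P$- and $I$-type objects throughout in (i), (ii), (iii) (hypotheses and conclusions), also hold.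
   Context: Quivers are finite: $Q=(Q_0,Q_1,s,t)$, with vertex set $Q_0$, arrow set $Q_1$, and functions $s,t$ giving the start and terminal vertex of each arrow; $Q$ is acyclic if it has no oriented cycles. A morphism of quivers sends vertices to vertices and arrows to arrows, compatibly with $s,t$. A quiver over $Q$ is a pair $(Q',f')$ with $f'\colon Q'\to Q$ a morphism of quivers (structure map); morphisms are morphisms of quivers commuting with structure maps. This category is denoted $\downarrow\! Q$. Paths include trivial paths. For a subquiver $T\subseteq Q$ (not necessarily full): - $E_T$ is $T$ with the inclusion $T\to Q$ as structure map. - If $T$ has a unique source $t$, $P_T$ has as vertices all paths in $T$ starting at $t$, each mapped to its endpoint in $Q$; there is an arrow $p\to q$ lying over $\alpha\in Q_1$ exactly when $q=p\alpha$ ($\alpha$ an arrow of $T$ appended to the end of $p$). - If $T$ has a unique sink $u$, $I_T$ is defined dually: vertices are all paths in $T$ ending at $u$, each mapped to its starting vertex, with an arrow $p\to q$ lying over $\alpha$ exactly when $p=\alpha q$. $P_T$ (resp. $I_T$) is only defined when $T$ has a unique source (resp. sink). PIE is the full subcategory of $\downarrow\! Q$ whose objects are all $P_T$, $I_T$, $E_T$ (when defined) as $T$ varies over nonempty connected subquivers of $Q$; isomorphic ones among these are identified, and equality such as $P_S=E_S$ means isomorphism of quivers over $Q$. An inequality such as $E_S\ne I_S$ is considered to hold when $I_S$ is not defined. PIE is a finite acyclic category (the only endomorphisms are identities and only identities are invertible). With $[x,y]$ the number of morphisms $x\to y$, the Möbius function $\mu\colon\mathrm{PIE}_0\times\mathrm{PIE}_0\to\mathbb{Z}$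 (where $\mathrm{PIE}_0$ is the set of objects) is the inverse matrix of $([x,y])_{x,y}$, i.e. $\sum_z[x,z]\mu(z,y)$ equals $1$ if $x=y$ and $0$ otherwise. Two subquivers $S,T\subseteq Q$ have the same skeleton if, for every pair of vertices $v,w\in Q_0$, there is at least one edge between $v$ and $w$ in $S$ exactly when there is at least one edge between $v$ and $w$ in $T$. When $S$ and $T$ have the same skeleton, $P_S$ exists if and only if $P_T$ exists, and similarly for $I$-type objects.
   Formalization: The formulas for μ(X,E_T) in (ii) and μ(Y,E_T) in (iii), and their duals, are asserted only when 𝒜 is nonempty; for S = T they fail, since then μ(X,E_T) = μ(Y,E_T) = 1. *)

(* Defs.v *)
From HB Require Import structures.
From mathcomp Require Import all_boot all_order all_algebra.
From mathcomp Require Import generic_quotient.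

Set Implicit Arguments.
Unset Strict Implicit.
Unset Printing Implicit Defensive.

Import GRing.Theory.
Local Open Scope quotient_scope.

Record quiver := Quiver {
  vert : finType;
  arr : finType;
  src : arr -> vert;
  tgt : arr -> vert
}.

(* [cycle] holds of the empty sequence, which is not an oriented cycle. *)
Definition acyclic (Q : quiver) : Prop :=
  forall c : seq (arr Q), cycle [rel a b | tgt a == src b] c -> c = [::].

Definition qmap (A B : quiver) : finType :=
  ({ffun vert A -> vert B} * {ffun arr A -> arr B})%type.

Definition is_hom (A B : quiver) (f : qmap A B) : bool :=
  [forall a : arr A, (src (f.2 a) == f.1 (src a)) && (tgt (f.2 a) == f.1 (tgt a))].

Definition qid (A : quiver) : qmap A A := ([ffun v => v], [ffun a => a]).

Definition qcomp (A B C : quiver) (g : qmap B C) (f : qmap A B) : qmap A C :=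
  ([ffun v => g.1 (f.1 v)], [ffun a => g.2 (f.2 a)]).

Record quiver_over (Q : quiver) := QuiverOver {
  total :> quiver;
  str : qmap total Q;
  strP : is_hom str
}.

Definition hom_over (Q : quiver) (X Y : quiver_over Q) : {set qmap X Y} :=
  [set f | is_hom f & qcomp (str Y) f == str X].

Definition isomorphic (Q : quiver) : rel (quiver_over Q) := fun X Y =>
  [exists f in hom_over X Y, exists g in hom_over Y X,
     (qcomp g f == qid X) && (qcomp f g == qid Y)].

Section Isomorphism.
Variable Q : quiver.
Implicit Types X Y Z : quiver_over Q.

Lemma qcompA (A B C D : quiver) (h : qmap C D) (g : qmap B C) (f : qmap A B) :
  qcomp h (qcomp g f) = qcomp (qcomp h g) f.
Proof. by congr pair; apply/ffunP => x; rewrite !ffunE. Qed.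

Lemma qcomp1f (A B : quiver) (f : qmap A B) : qcomp (qid B) f = f.
Proof. by case: f => f0 f1; congr pair; apply/ffunP => x; rewrite !ffunE. Qed.

Lemma qcompf1 (A B : quiver) (f : qmap A B) : qcomp f (qid A) = f.
Proof. by case: f => f0 f1; congr pair; apply/ffunP => x; rewrite !ffunE. Qed.

Lemma qid_hom_over X : qid X \in hom_over X X.
Proof.
rewrite inE qcompf1 eqxx andbT.
by apply/forallP => a; rewrite !ffunE !eqxx.
Qed.

Lemma qcomp_hom_over X Y Z f g :
  g \in hom_over Y Z -> f \in hom_over X Y -> qcomp g f \in hom_over X Z.
Proof.
rewrite !inE => /andP[/forallP gH /eqP gS] /andP[/forallP fH /eqP fS].
rewrite qcompA gS fS eqxx andbT; apply/forallP => a; rewrite !ffunE.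
have /andP[/eqP <- /eqP <-] := fH a.
by have /andP[-> ->] := gH (f.2 a).
Qed.

Lemma isomorphic_refl : reflexive (@isomorphic Q).
Proof.
move=> X; apply/exists_inP; exists (qid X); first exact: qid_hom_over.
apply/exists_inP; exists (qid X); first exact: qid_hom_over.
by rewrite qcompf1 eqxx.
Qed.

Lemma isomorphic_sym : symmetric (@isomorphic Q).
Proof.
suff H X Y : isomorphic X Y -> isomorphic Y X by move=> X Y; apply/idP/idP; apply: H.
move=> /exists_inP[f fH /exists_inP[g gH /andP[gf fg]]].
by apply/exists_inP; exists g => //; apply/exists_inP; exists f; rewrite ?gf ?fg.
Qed.

Lemma isomorphic_trans : transitive (@isomorphic Q).
Proof.
move=> Y X Z /exists_inP[f fH /exists_inP[g gH /andP[/eqP gf /eqP fg]]].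
move=> /exists_inP[h hH /exists_inP[k kH /andP[/eqP kh /eqP hk]]].
apply/exists_inP; exists (qcomp h f); first exact: qcomp_hom_over hH fH.
apply/exists_inP; exists (qcomp g k); first exact: qcomp_hom_over gH kH.
rewrite -(qcompA g) (qcompA k) kh qcomp1f gf eqxx.
by rewrite -(qcompA h) (qcompA f) fg qcomp1f hk eqxx.
Qed.

End Isomorphism.

Section Subquivers.
Variable Q : quiver.

Definition is_subquiver (T : {set vert Q} * {set arr Q}) : bool :=
  [forall a in T.2, (src a \in T.1) && (tgt a \in T.1)].

Definition subquiver : finType :=
  {T : {set vert Q} * {set arr Q} | is_subquiver T}.

Definition sub_vert (T : subquiver) : {set vert Q} := (sval T).1.
Definition sub_arr (T : subquiver) : {set arr Q} := (sval T).2.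

Lemma sub_arrP (T : subquiver) a :
  a \in sub_arr T -> (src a \in sub_vert T) && (tgt a \in sub_vert T).
Proof. by move=> aT; have /forall_inP/(_ a aT) := svalP T. Qed.

Definition sub_included (S T : subquiver) : bool :=
  (sub_vert S \subset sub_vert T) && (sub_arr S \subset sub_arr T).

Definition adjacent (T : subquiver) : rel (vert Q) := fun v w =>
  [exists a in sub_arr T,
     ((src a == v) && (tgt a == w)) || ((src a == w) && (tgt a == v))].

Definition nonempty_connected (T : subquiver) : bool :=
  (sub_vert T != set0) &&
  [forall v in sub_vert T, forall w in sub_vert T, connect (adjacent T) v w].

Definition same_skeleton (S T : subquiver) : Prop :=
  forall v w, adjacent S v w = adjacent T v w.

Definition sources (T : subquiver) : {set vert Q} :=
  [set v in sub_vert T | [forall a in sub_arr T, tgt a != v]].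

Definition sinks (T : subquiver) : {set vert Q} :=
  [set v in sub_vert T | [forall a in sub_arr T, src a != v]].

Definition unique_source (T : subquiver) : bool := #|sources T| == 1.
Definition unique_sink (T : subquiver) : bool := #|sinks T| == 1.

End Subquivers.

Section Paths.
Variable Q : quiver.

Fixpoint walk (v : vert Q) (s : seq (arr Q)) : bool :=
  if s is a :: s' then (src a == v) && walk (tgt a) s' else true.

(* The pair (v, s) is the path starting at v that runs through the arrows of s,
   in this order; (v, [::]) is the trivial path at v. The bound on the length,
   which makes the type finite, excludes no path of an acyclic quiver: see
   acyclic_walk_size. *)
Definition qpath : finType := (vert Q * #|arr Q|.-bseq (arr Q))%type.

Definition path_in (T : subquiver Q) (p : qpath) : bool :=
  [&& p.1 \in sub_vert T, all [in sub_arr T] p.2 & walk p.1 p.2].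

Definition pend (p : qpath) : vert Q := last p.1 (map (@tgt Q) p.2).

(* q = p a *)
Definition is_append (p : qpath) (a : arr Q) (q : qpath) : bool :=
  [&& pend p == src a, q.1 == p.1 & q.2 == rcons p.2 a :> seq (arr Q)].

(* p = a q *)
Definition is_prepend (p : qpath) (a : arr Q) (q : qpath) : bool :=
  [&& tgt a == q.1, p.1 == src a & p.2 == a :: q.2 :> seq (arr Q)].

Lemma walk_cat v s1 s2 :
  walk v (s1 ++ s2) = walk v s1 && walk (last v (map (@tgt Q) s1)) s2.
Proof. by elim: s1 v => //= a s1 IH v; rewrite IH andbA. Qed.

Lemma walk_path a s :
  walk (tgt a) s = path [rel a b : arr Q | tgt a == src b] a s.
Proof. by elim: s a => //= b s IH a; rewrite IH eq_sym. Qed.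

Lemma acyclic_walk_size v s : acyclic Q -> walk v s -> size s <= #|arr Q|.
Proof.
move=> acQ; suff us : walk v s -> uniq s.
  by move=> /us /card_uniqP <-; apply: max_card.
elim: s v => //= a s IH v /andP[_ ws]; rewrite (IH _ ws) andbT.
apply/negP => as_; case/splitPr: as_ ws => s1 s2; rewrite walk_path => H.
suff /acQ : cycle [rel a b : arr Q | tgt a == src b] (a :: s1) by [].
by move: H; rewrite /= -cat_rcons cat_path => /andP[].
Qed.

End Paths.

Variant pie_kind := KP | KI | KE.

Definition pie_kind_code (k : pie_kind) : option bool :=
  match k with KP => Some true | KI => Some false | KE => None end.
Definition pie_kind_decode (c : option bool) : pie_kind :=
  match c with Some true => KP | Some false => KI | None => KE end.
Lemma pie_kind_codeK : cancel pie_kind_code pie_kind_decode.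
Proof. by case. Qed.
HB.instance Definition _ := Finite.copy pie_kind (can_type pie_kind_codeK).

Section PIE.
Variable Q : quiver.
Implicit Type T : subquiver Q.

Section E_object.
Variable T : subquiver Q.

Definition E_vert : finType := {v : vert Q | v \in sub_vert T}.
Definition E_arr : finType := {a : arr Q | a \in sub_arr T}.

Definition E_src (a : E_arr) : E_vert :=
  exist _ (src (val a)) (proj1 (andP (sub_arrP (valP a)))).
Definition E_tgt (a : E_arr) : E_vert :=
  exist _ (tgt (val a)) (proj2 (andP (sub_arrP (valP a)))).

Definition E_quiver := Quiver E_src E_tgt.

Definition E_str : qmap E_quiver Q := ([ffun v => val v], [ffun a => val a]).

Lemma E_strP : is_hom E_str.
Proof. by apply/forallP => a; rewrite !ffunE !eqxx. Qed.

Definition E_obj := QuiverOver E_strP.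
End E_object.

(* P_obj T and I_obj T are meaningful only when T has a unique source,
   resp. a unique sink; this is imposed in pie_defined. *)
Section P_object.
Variable T : subquiver Q.

Definition P_vert : finType :=
  {p : qpath Q | path_in T p && (p.1 \in sources T)}.
Definition P_arr : finType :=
  {x : P_vert * arr Q * P_vert | is_append (val x.1.1) x.1.2 (val x.2)}.

Definition P_src (x : P_arr) : P_vert := (val x).1.1.
Definition P_tgt (x : P_arr) : P_vert := (val x).2.

Definition P_quiver := Quiver P_src P_tgt.

Definition P_str : qmap P_quiver Q :=
  ([ffun p : P_vert => pend (val p)], [ffun x : P_arr => (val x).1.2]).

Lemma P_strP : is_hom P_str.
Proof.
apply/forallP => x; rewrite !ffunE /P_src /P_tgt.
have /and3P[/eqP-> _ /eqP q2] := valP x.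
by rewrite eqxx /pend q2 map_rcons last_rcons eqxx.
Qed.

Definition P_obj := QuiverOver P_strP.
End P_object.

Section I_object.
Variable T : subquiver Q.

Definition I_vert : finType :=
  {p : qpath Q | path_in T p && (pend p \in sinks T)}.
Definition I_arr : finType :=
  {x : I_vert * arr Q * I_vert | is_prepend (val x.1.1) x.1.2 (val x.2)}.

Definition I_src (x : I_arr) : I_vert := (val x).1.1.
Definition I_tgt (x : I_arr) : I_vert := (val x).2.

Definition I_quiver := Quiver I_src I_tgt.

Definition I_str : qmap I_quiver Q :=
  ([ffun p : I_vert => (val p).1], [ffun x : I_arr => (val x).1.2]).

Lemma I_strP : is_hom I_str.
Proof.
apply/forallP => x; rewrite !ffunE /I_src /I_tgt.
by have /and3P[-> /eqP -> _] := valP x; rewrite eqxx.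
Qed.

Definition I_obj := QuiverOver I_strP.
End I_object.

Definition pie_label : finType := (pie_kind * subquiver Q)%type.

Definition pie_obj (x : pie_label) : quiver_over Q :=
  match x.1 with KP => P_obj x.2 | KI => I_obj x.2 | KE => E_obj x.2 end.

Definition pie_defined (x : pie_label) : bool :=
  nonempty_connected x.2 &&
  match x.1 with
  | KP => unique_source x.2
  | KI => unique_sink x.2
  | KE => true
  end.

(* Its negation also holds when one of the two objects is not defined. *)
Definition pie_eq (x y : pie_label) : bool :=
  [&& pie_defined x, pie_defined y & isomorphic (pie_obj x) (pie_obj y)].

Definition pie_valid : finType := {x : pie_label | pie_defined x}.

Definition pie_iso : rel pie_valid :=
  fun x y => isomorphic (pie_obj (val x)) (pie_obj (val y)).

Lemma pie_iso_refl : reflexive pie_iso.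
Proof. by move=> x; apply: isomorphic_refl. Qed.
Lemma pie_iso_sym : symmetric pie_iso.
Proof. by move=> x y; apply: isomorphic_sym. Qed.
Lemma pie_iso_trans : transitive pie_iso.
Proof. by move=> y x z; apply: isomorphic_trans. Qed.

Canonical pie_equiv := EquivRel pie_iso pie_iso_refl pie_iso_sym pie_iso_trans.

Definition pie0 : predArgType := {eq_quot pie_iso}.
HB.instance Definition _ := EqQuotient.on pie0.
HB.instance Definition _ :=
  Finite.copy pie0 (can_type (@EquivQuot.ereprK _ _ _ _ _ _)).

Definition pie_class (x : pie_label) (hx : pie_defined x) : pie0 :=
  \pi_pie0 (exist _ x hx).

Lemma pie_eqE (x y : pie_label) (hx : pie_defined x) (hy : pie_defined y) :
  pie_eq x y = (pie_class hx == pie_class hy).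
Proof.
by rewrite /pie_eq hx hy; apply/idP/eqP => [H|/eqmodP//]; apply/eqmodP.
Qed.

Definition num_hom (c d : pie0) : nat :=
  #|hom_over (pie_obj (val (repr c))) (pie_obj (val (repr d)))|.

Definition hom_mx : 'M[int]_#|pie0| :=
  \matrix_(i, j) Posz (num_hom (enum_val i) (enum_val j)).

(* For acyclic Q the category is acyclic, so hom_mx is unitriangular for a
   suitable order of the objects, hence invertible over int and invmx hom_mx is
   its genuine inverse. *)
Definition mobius (c d : pie0) : int := invmx hom_mx (enum_rank c) (enum_rank d).

(* The value is asserted only when both objects are defined. *)
Definition mobius_eq (x y : pie_label) (n : int) : Prop :=
  forall (hx : pie_defined x) (hy : pie_defined y),
    mobius (pie_class hx) (pie_class hy) = n.

End PIE.

(* Main.v *)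
(* A morphism into E_T is unique and exists as soon as supports are included. P_T is a rooted
   out-tree lying over T by unique lifting of outgoing arrows, so a morphism P_S -> P_T is
   determined by the image of the root; when S and T have the same skeleton there is exactly
   one. A morphism between objects of different types that ends in P_T forces the domain to be
   itself an out-tree (P_S = E_S), and one between P- and I-type objects forces S to be a line
   (P_S = E_S = I_S). Adding an arrow to S without changing the skeleton creates parallel arrows,
   so every R in [S, T] other than S is nondegenerate: P_R, I_R and E_R are distinct. The rows
   sum_z [x, z] mu(z, y) = delta(x, y) thus become sums over the Boolean interval of subquivers
   R between S and T, of mu(E_R, y) for x = E_S and of mu(E_R, y) + mu(P_R, y) for x = P_S, and
   Boolean inversion gives the values. For a degenerate S only the term R = S changes. *)

Require Import Defs.
From HB Require Import structures.
From mathcomp Require Import all_boot all_order all_algebra.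
From mathcomp Require Import perm generic_quotient.

Set Implicit Arguments.
Unset Strict Implicit.
Unset Printing Implicit Defensive.

Import GRing.Theory Num.Theory.
Local Open Scope quotient_scope.

(** * Embedded objects, rooted trees and images of structure maps *)

Definition mono (Q : quiver) (X : quiver_over Q) : Prop :=
  injective (str X).1 /\ injective (str X).2.

(* The last clause says that every vertex is reachable from the root. *)
Definition out_tree (Q : quiver) (X : quiver_over Q) (t : vert Q) : Prop :=
  exists r : vert X,
    [/\ (str X).1 r = t,
        forall a : arr X, tgt ((str X).2 a) <> t,
        injective (@tgt X),
        forall a b : arr X, src a = src b -> (str X).2 a = (str X).2 b -> a = b &
        forall K : pred (vert X),
          K r -> (forall a, K (src a) -> K (tgt a)) -> forall v, K v].

(** The image of a structure map depends only on the isomorphism class ([supported_isomorphic]), so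
    an object of PIE determines its subquiver. *)
Definition supported (Q : quiver) (X : quiver_over Q)
    (V : {set vert Q}) (B : {set arr Q}) : Prop :=
  codom (str X).1 =i V /\ codom (str X).2 =i B.

(** * Opposite quivers *)

Section Opposite.
Variable Q : quiver.

(** Reversal keeps the vertex and arrow types, so a map of quivers is also a map of their opposites
    by conversion. Statements on sinks and I-type objects are thereby obtained from those on sources
    and out-trees. *)
Definition qop (A : quiver) : quiver := Quiver (@tgt A) (@src A).

Lemma is_hom_op (A B : quiver) (f : qmap A B) :
  is_hom (f : qmap (qop A) (qop B)) = is_hom f.
Proof. by apply: eq_forallb => a; rewrite andbC. Qed.

Lemma over_op_subproof (X : quiver_over Q) :
  is_hom (str X : qmap (qop X) (qop Q)).
Proof. by rewrite is_hom_op; apply: strP. Qed.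

Definition over_op (X : quiver_over Q) : quiver_over (qop Q) :=
  QuiverOver (over_op_subproof X).

Lemma hom_over_op (X Y : quiver_over Q) f : f \in hom_over X Y ->
  (f : qmap (over_op X) (over_op Y)) \in hom_over (over_op X) (over_op Y).
Proof. by rewrite !inE is_hom_op. Qed.

Lemma sub_op_subproof (T : subquiver Q) :
  is_subquiver (sval T : {set vert (qop Q)} * {set arr (qop Q)}).
Proof. by apply/forall_inP => a aT; rewrite andbC; apply: (@sub_arrP Q T). Qed.

Definition sub_op (T : subquiver Q) : subquiver (qop Q) :=
  exist (fun U => is_subquiver U) _ (sub_op_subproof T).

Lemma adjacent_op (T : subquiver Q) : adjacent (sub_op T) =2 adjacent T.
Proof.
by move=> v w; apply: eq_existsb => a; rewrite /= orbC -!(andbC (tgt a == _)).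
Qed.

Lemma nonempty_connected_op (T : subquiver Q) :
  nonempty_connected (sub_op T) = nonempty_connected T.
Proof.
congr andb; apply: eq_forallb_in => v _; apply: eq_forallb_in => w _.
exact: eq_connect (adjacent_op T) v w.
Qed.

Lemma acyclic_op : acyclic Q -> acyclic (qop Q).
Proof.
move=> acQ c cyc; suff : rev c = [::] by move/(congr1 rev); rewrite revK.
apply: acQ; rewrite rev_cycle; congr (is_true _): cyc.
by apply: eq_cycle => a b /=; rewrite eq_sym.
Qed.

End Opposite.

(** * Existence and uniqueness of morphisms over Q *)

Section Homs.
Variable Q : quiver.
Implicit Types X Y Z : quiver_over Q.

Lemma hom_overP X Y (f : qmap X Y) : f \in hom_over X Y ->
  [/\ forall a, src (f.2 a) = f.1 (src a), forall a, tgt (f.2 a) = f.1 (tgt a),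
      forall v, (str Y).1 (f.1 v) = (str X).1 v &
      forall a, (str Y).2 (f.2 a) = (str X).2 a].
Proof.
rewrite inE => /andP[/forallP fH /eqP fS]; split=> x.
- by have /andP[/eqP] := fH x.
- by have /andP[_ /eqP] := fH x.
- by rewrite -fS ffunE.
- by rewrite -fS ffunE.
Qed.

Lemma str_src X (a : arr X) : src ((str X).2 a) = (str X).1 (src a).
Proof. by have /forallP/(_ a)/andP[/eqP] := strP X. Qed.

Lemma str_tgt X (a : arr X) : tgt ((str X).2 a) = (str X).1 (tgt a).
Proof. by have /forallP/(_ a)/andP[_ /eqP] := strP X. Qed.

Lemma qmap_ext (A B : quiver) (f g : qmap A B) :
  f.1 =1 g.1 -> f.2 =1 g.2 -> f = g.
Proof. by case: f g => [f0 f1] [g0 g1] /= /ffunP -> /ffunP ->. Qed.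

Lemma hom_mono_uniq X Y f g : mono Y ->
  f \in hom_over X Y -> g \in hom_over X Y -> f = g.
Proof.
case=> iv ia /hom_overP[_ _ f0 f1] /hom_overP[_ _ g0 g1].
by apply: qmap_ext => x; [apply: iv; rewrite f0 g0 | apply: ia; rewrite f1 g1].
Qed.

Lemma hom_support X Y V B W C f :
  f \in hom_over X Y -> supported X V B -> supported Y W C ->
  (V \subset W) && (B \subset C).
Proof.
move=> /hom_overP[_ _ f0 f1] [XV XB] [YV YB].
apply/andP; split; apply/subsetP => x.
  by rewrite -XV -YV => /codomP[v ->]; rewrite -f0 codom_f.
by rewrite -XB -YB => /codomP[v ->]; rewrite -f1 codom_f.
Qed.

(** Each vertex and arrow has exactly one lift to [Y]: injectivity allows at most one and the
    inclusion of images provides it. Compatibility of the lifts with sources and targets follows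
    from injectivity on vertices. *)
Lemma card_hom_mono X Y V B W C : mono Y ->
  supported X V B -> supported Y W C -> V \subset W -> B \subset C ->
  #|hom_over X Y| = 1.
Proof.
move=> mY [XV XB] [YV YB] /subsetP VW /subsetP BC.
have lv v : (str X).1 v \in codom (str Y).1 by rewrite YV VW // -XV codom_f.
have la a : (str X).2 a \in codom (str Y).2 by rewrite YB BC // -XB codom_f.
pose f : qmap X Y := ([ffun v => iinv (lv v)], [ffun a => iinv (la a)]).
have fH : f \in hom_over X Y.
  rewrite inE; apply/andP; split.
    apply/forallP => a; rewrite !ffunE; apply/andP; split; apply/eqP.
      by apply: mY.1; rewrite -str_src !f_iinv str_src.
    by apply: mY.1; rewrite -str_tgt !f_iinv str_tgt.
  by apply/eqP/qmap_ext => x; rewrite !ffunE f_iinv.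
rewrite (_ : hom_over X Y = [set f]) ?cards1 //.
by apply/setP => g; rewrite inE; apply/idP/eqP => [gH | -> //]; apply: hom_mono_uniq gH fH.
Qed.

Lemma isomorphic_mono X Y V B : mono X -> mono Y ->
  supported X V B -> supported Y V B -> isomorphic X Y.
Proof.
move=> mX mY sX sY.
have /eqP/cards1P[f fE] := card_hom_mono mY sX sY (subxx _) (subxx _).
have /eqP/cards1P[g gE] := card_hom_mono mX sY sX (subxx _) (subxx _).
have fH : f \in hom_over X Y by rewrite fE set11.
have gH : g \in hom_over Y X by rewrite gE set11.
apply/exists_inP; exists f => //; apply/exists_inP; exists g => //.
apply/andP; split; apply/eqP.
  exact: hom_mono_uniq mX (qcomp_hom_over gH fH) (qid_hom_over X).
exact: hom_mono_uniq mY (qcomp_hom_over fH gH) (qid_hom_over Y).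
Qed.

Lemma card_hom_isomorphic_le X X' Y Y' : isomorphic X X' -> isomorphic Y Y' ->
  #|hom_over X Y| <= #|hom_over X' Y'|.
Proof.
move=> /exists_inP[f fH /exists_inP[g gH /andP[/eqP gf /eqP fg]]].
move=> /exists_inP[h hH /exists_inP[k kH /andP[/eqP kh /eqP hk]]].
rewrite -(card_in_imset (f := fun u => qcomp h (qcomp u g))); last first.
  move=> u v _ _ /(congr1 (fun w => qcomp k (qcomp w f))).
  by rewrite -!qcompA gf !qcompf1 !qcompA kh !qcomp1f.
apply/subset_leq_card/subsetP => _ /imsetP[u uH ->].
exact: qcomp_hom_over hH (qcomp_hom_over uH gH).
Qed.

Lemma card_hom_isomorphic X X' Y Y' : isomorphic X X' -> isomorphic Y Y' ->
  #|hom_over X Y| = #|hom_over X' Y'|.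
Proof.
move=> iX iY; apply/eqP; rewrite eqn_leq card_hom_isomorphic_le //.
by apply: card_hom_isomorphic_le; rewrite isomorphic_sym.
Qed.

Lemma supported_isomorphic X Y V B W C : isomorphic X Y ->
  supported X V B -> supported Y W C -> V = W /\ B = C.
Proof.
move=> /exists_inP[f fH /exists_inP[g gH _]] sX sY.
have /andP[VW BC] := hom_support fH sX sY.
have /andP[WV CB] := hom_support gH sY sX.
by split; apply/eqP; rewrite eqEsubset ?VW ?WV ?BC ?CB.
Qed.

(** Every vertex of [Y] except the root receives an arrow, and no arrow of [Y] lies over one ending
    at [t], so the root is the only vertex over [t]. Both morphisms therefore agree on the root of
    [X], and unique lifting of outgoing arrows propagates the agreement. *)
Lemma out_tree_hom_uniq X Y t f g : out_tree X t -> out_tree Y t ->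
  f \in hom_over X Y -> g \in hom_over X Y -> f = g.
Proof.
move=> [r [rt _ _ _ indX]] [s [st noin _ starY indY]].
move=> /hom_overP[fs ft f0 f1] /hom_overP[gs gt g0 g1].
have over_t v : (str Y).1 v = t -> v = s.
  have: (v == s) || [exists a, tgt a == v].
    apply: (indY (fun v => (v == s) || [exists a, tgt a == v])) => [|a _].
      by rewrite eqxx.
    by apply/orP; right; apply/existsP; exists a.
  by case/orP=> [/eqP // | /existsP[a /eqP <-]]; rewrite -str_tgt => /noin.
have fg2 a : f.1 (src a) = g.1 (src a) -> f.2 a = g.2 a.
  by move=> e; apply: starY; rewrite ?fs ?gs ?f1 ?g1.
have fg1 v : f.1 v = g.1 v.
  apply/eqP; apply: (indX (fun v => f.1 v == g.1 v)) => [|a /eqP /fg2 e].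
    by apply/eqP; transitivity s; [|symmetry]; apply: over_t; rewrite -rt.
  by rewrite -ft -gt e.
by apply: qmap_ext => // a; apply: fg2.
Qed.

(** If two vertices lie over the same vertex, the arrows entering them have the same image, so their
    sources lie over the same vertex as well. Induction from the root makes the sources equal, and
    then unique lifting makes the arrows equal. *)
Lemma out_tree_mono X t : out_tree X t ->
  (forall a b : arr X, tgt ((str X).2 a) = tgt ((str X).2 b) ->
     (str X).2 a = (str X).2 b) ->
  mono X.
Proof.
move=> [r [rt noin _ starX indX]] tinj.
have inP v : v = r \/ exists a, v = tgt a.
  have: (v == r) || [exists a, v == tgt a].
    apply: (indX (fun v => (v == r) || [exists a, v == tgt a])) => [|a _].
      by rewrite eqxx.
    by apply/orP; right; apply/existsP; exists a.
  by case/orP => [/eqP | /existsP[a /eqP]]; [left | right; exists a].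
have inj0 : injective (str X).1.
  move=> v w /eqP vw; apply/eqP; move: v w vw; pose K v :=
    [forall w, ((str X).1 v == (str X).1 w) ==> (v == w)].
  suff KP v : K v by move=> v w vw; have /forallP/(_ w) := KP v; rewrite vw.
  apply: indX => [|a /forallP IH]; apply/forallP => w; apply/implyP => /eqP.
    case: (inP w) => [-> // | [a ->]].
    by rewrite rt -str_tgt => /esym /noin.
  case: (inP w) => [-> | [b ->]].
    by rewrite rt -str_tgt => /noin.
  rewrite -!str_tgt => /tinj ab; apply/eqP; congr tgt; apply: starX => //.
  by apply/eqP; have := IH (src b); rewrite -!str_src ab eqxx.
by split=> // a b ab; apply: starX => //; apply: inj0; rewrite -!str_src ab.
Qed.

End Homs.

(** * Reachability along arrows in an acyclic quiver *)

Section Reachability.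
Variable Q : quiver.
Implicit Types (B : {set arr Q}) (T : subquiver Q).

Definition step B : rel (vert Q) :=
  fun v w => [exists a in B, (src a == v) && (tgt a == w)].

Lemma stepE B a : a \in B -> step B (src a) (tgt a).
Proof. by move=> aB; apply/exists_inP; exists a; rewrite ?eqxx. Qed.

Lemma connect_walk B v w : connect (step B) v w ->
  exists s, [/\ all [in B] s, walk v s & last v (map (@tgt Q) s) = w].
Proof.
case/connectP => p; elim: p v => [|x p IH] v /=.
  by move=> _ ->; exists [::].
case/andP => /exists_inP[a aB /andP[/eqP <- /eqP ax]] px.
move/(IH _ px) => [s [sB ws <-]]; exists (a :: s).
by rewrite /= aB eqxx sB ax ws.
Qed.

Lemma connect_last (V : finType) (e : rel V) x y : connect e x y ->
  x = y \/ exists2 z, connect e x z & e z y.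
Proof.
case/connectP => p; case/lastP: p => [|p z] /=; first by left.
rewrite last_rcons rcons_path => /andP[px ez] ->; right.
by exists (last x p) => //; apply/connectP; exists p.
Qed.

Lemma connect_first (V : finType) (e : rel V) x y : connect e x y ->
  x = y \/ exists2 z, e x z & connect e z y.
Proof.
case/connectP => [[|z p]] /=; first by left.
by case/andP=> xz pz ->; right; exists z => //; apply/connectP; exists p.
Qed.

Hypothesis acQ : acyclic Q.

Lemma acyclic_connect B a : connect (step B) (tgt a) (src a) = false.
Proof.
apply/negP => /connect_walk[s [_ ws]].
rewrite last_map => /eqP ls; rewrite walk_path in ws.
by have /acQ: cycle [rel a b : arr Q | tgt a == src b] (a :: s) by rewrite /= rcons_path ws.
Qed.

(** Among the vertices that reach [v], one with the fewest ancestors is a source: the start of an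
    arrow into it would have strictly fewer, since by acyclicity the end of the arrow is not an
    ancestor of its start. *)
Lemma source_above T v : v \in sub_vert T ->
  exists2 s, s \in sources T & connect (step (sub_arr T)) s v.
Proof.
move=> vT; set e := step _.
pose anc w := #|[pred u | connect e u w]|.
case: (@arg_minnP _ v (fun w => connect e w v) anc) => [|w wv wmin]; first exact: connect0.
exists w => //; rewrite inE; apply/andP; split.
  case: (connect_first wv) => [-> // | [z /exists_inP[a aT /andP[/eqP <- _]] _]].
  by case/andP: (sub_arrP aT).
apply/forall_inP => a aT; apply/eqP => aw; subst w.
have aE : e (src a) (tgt a) by apply: stepE.
have := wmin _ (connect_trans (connect1 aE) wv).
rewrite leqNgt => /negP; apply; apply/proper_card/properP; split.
  by apply/subsetP => u; rewrite !inE => /connect_trans; apply; apply: connect1.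
by exists (tgt a); rewrite !inE ?connect0 ?acyclic_connect.
Qed.

Lemma reach_source T t v : sources T = [set t] -> v \in sub_vert T ->
  connect (step (sub_arr T)) t v.
Proof. by move=> tT /source_above[s]; rewrite tT => /set1P ->. Qed.

Lemma adjacent_sym T : symmetric (adjacent T).
Proof. by move=> v w; apply: eq_existsb => a; rewrite orbC. Qed.

(** The descendants of a source [s] are closed under adjacency: an arrow into a descendant other
    than [s] is the only one there, hence the last arrow of a path from [s]. By connectedness they
    are all the vertices, and a second source cannot be a descendant. *)
Lemma tgt_inj_unique_source T : nonempty_connected T ->
  {in sub_arr T &, injective (@tgt Q)} -> unique_source T.
Proof.
case/andP => /set0Pn[v vT] conT tinj.
have [s sT _] := source_above vT.
have sin : s \in sub_vert T by move: sT; rewrite inE => /andP[].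
have snoin a : a \in sub_arr T -> tgt a != s.
  by move: sT; rewrite inE => /andP[_ /forall_inP]; apply.
pose D := [pred w | connect (step (sub_arr T)) s w].
have closD : closed (adjacent T) D.
  apply: intro_closed; first exact: sym_connect_sym (adjacent_sym T).
  move=> x y /exists_inP[a aT /orP[] /andP[/eqP ax /eqP ay]]; subst x y; rewrite !inE => sx.
    exact: connect_trans sx (connect1 (stepE aT)).
  case: (connect_last sx) => [sE | [z sz /exists_inP[b bT /andP[/eqP bz /eqP ab]]]].
    by have := snoin _ aT; rewrite -sE eqxx.
  by rewrite -(tinj _ _ bT aT ab) bz.
apply/cards1P; exists s; apply/setP => w; rewrite [RHS]inE; apply/idP/eqP => [wT | -> //].
have win : w \in sub_vert T by move: wT; rewrite inE => /andP[].
have sw : connect (adjacent T) s w.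
  by move/forall_inP: conT => /(_ s sin) /forall_inP /(_ w win).
have := closed_connect closD sw; rewrite !inE connect0 => /esym /connect_last[// | [z _]].
case/exists_inP => a aT /andP[_ /eqP aw].
by move: wT; rewrite inE => /andP[_ /forall_inP /(_ a aT)]; rewrite aw eqxx.
Qed.

(** With at most one arrow leaving each vertex the tree is a line, so any two vertices are
    comparable. Two distinct comparable vertices with the same image would yield an oriented cycle
    in Q. *)
Lemma out_tree_src_inj_mono (X : quiver_over Q) t :
  out_tree X t -> injective (@src X) -> mono X.
Proof.
move=> [r [_ _ _ _ indX]] sinj.
pose e : rel (vert X) := fun v w => [exists a : arr X, (src a == v) && (tgt a == w)].
have eE a : e (src a) (tgt a) by apply/existsP; exists a; rewrite !eqxx.
have comp v w : connect e v w || connect e w v.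
  move: w; apply/forallP; apply: (indX (fun v => [forall w, connect e v w || connect e w v])).
    apply/forallP => w; apply/orP; left; apply: (indX (connect e r)); first exact: connect0.
    by move=> a ra; apply: connect_trans ra (connect1 (eE a)).
  move=> a /forallP IH; apply/forallP => w; case/orP: (IH w).
    case/connect_first => [<- | [z /existsP[b /andP[/eqP/sinj <- /eqP <-]] ->] //].
    by rewrite (connect1 (eE a)) orbT.
  by move=> wa; rewrite (connect_trans wa (connect1 (eE a))) orbT.
have inj0 : injective (str X).1.
  suff H v w : (str X).1 v = (str X).1 w -> connect e v w -> v = w.
    by move=> v w vw; case/orP: (comp v w) => [/H | /H /esym]; apply.
  move=> vw /connect_first[// | [z /existsP[a /andP[/eqP av /eqP az]] zw]].
  have : connect (step setT) (tgt ((str X).2 a)) (src ((str X).2 a)).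
    rewrite str_tgt str_src az av vw.
    case/connectP: zw => p pz ->; apply/connectP; exists (map (str X).1 p); rewrite ?last_map //.
    rewrite path_map; apply: sub_path pz => x y /existsP[b /andP[/eqP <- /eqP <-]] /=.
    by rewrite -str_src -str_tgt stepE.
  by rewrite acyclic_connect.
by split=> // a b ab; apply/sinj/inj0; rewrite -!str_src ab.
Qed.

End Reachability.

(** * P-type objects as out-trees; supports of E- and P-type objects *)

Section ProjectiveObjects.
Variable Q : quiver.
Hypothesis acQ : acyclic Q.
Implicit Types S T : subquiver Q.

Lemma triple_ext (A B C : Type) (u v : A * B * C) :
  u.1.1 = v.1.1 -> u.1.2 = v.1.2 -> u.2 = v.2 -> u = v.
Proof. by case: u v => [[? ?] ?] [[? ?] ?] /= -> -> ->. Qed.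

Lemma qpath_ext (p q : qpath Q) :
  p.1 = q.1 -> p.2 = q.2 :> seq (arr Q) -> p = q.
Proof. by case: p q => [v s] [w u] /= -> /val_inj ->. Qed.

(** Acyclicity supplies the length bound built into the type of paths. *)
Lemma path_inP T v s : v \in sub_vert T -> all [in sub_arr T] s -> walk v s ->
  exists p : qpath Q, [/\ path_in T p, p.1 = v & p.2 = s :> seq (arr Q)].
Proof.
move=> vT sT ws; exists (v, Bseq (acyclic_walk_size acQ ws)).
by rewrite /path_in vT sT ws.
Qed.

Lemma path_in_end T p : path_in T p -> pend p \in sub_vert T.
Proof.
case: p => v [s sz] /and3P[/= vT sT _]; rewrite /pend /=.
elim: s v vT sT {sz} => //= a s IH v _ /andP[aT sT]; apply: IH => //.
by case/andP: (sub_arrP aT).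
Qed.

Lemma sources_sub T v : v \in sources T -> v \in sub_vert T.
Proof. by rewrite inE => /andP[]. Qed.

Lemma E_obj_supported T : supported (E_obj T) (sub_vert T) (sub_arr T).
Proof.
split=> x; apply/codomP/idP => [[y ->] | xT]; rewrite ?ffunE ?(valP y) //.
  by exists (exist _ x xT); rewrite ffunE.
by exists (exist _ x xT); rewrite ffunE.
Qed.

Lemma E_obj_mono T : mono (E_obj T).
Proof. by split=> x y; rewrite !ffunE; apply: val_inj. Qed.

Lemma P_vertP T v s : v \in sources T -> all [in sub_arr T] s -> walk v s ->
  exists p : P_vert T, (val p).1 = v /\ (val p).2 = s :> seq (arr Q).
Proof.
move=> vs sT ws; have [p [pT p1 p2]] := path_inP (sources_sub vs) sT ws.
have pP : path_in T p && (p.1 \in sources T) by rewrite pT p1.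
by exists (exist _ p pP).
Qed.

Lemma P_arrP T (x : P_arr T) :
  [/\ pend (val (P_src x)) = src (val x).1.2,
      (val (P_tgt x)).1 = (val (P_src x)).1 &
      (val (P_tgt x)).2 = rcons (val (P_src x)).2 (val x).1.2 :> seq (arr Q)].
Proof. by case: x => [[[p a] q] H]; case/and3P: (H) => /eqP e1 /eqP e2 /eqP e3. Qed.

Lemma P_vert_ext T (p q : P_vert T) : (val p).1 = (val q).1 ->
  (val p).2 = (val q).2 :> seq (arr Q) -> p = q.
Proof. by move=> e1 e2; apply/val_inj/qpath_ext. Qed.

Lemma P_arr_ext T (x y : P_arr T) : P_src x = P_src y -> (val x).1.2 = (val y).1.2 ->
  P_tgt x = P_tgt y -> x = y.
Proof. by move=> e1 e2 e3; apply/val_inj/triple_ext. Qed.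

Lemma P_arr_in T (x : P_arr T) : (val x).1.2 \in sub_arr T.
Proof.
have [_ _ q2] := P_arrP x; have := valP (P_tgt x).
by case/andP => /and3P[_ + _] _; rewrite q2 all_rcons => /andP[].
Qed.

(** Every vertex of [T] is reached from the unique source, so it is the end of some path; an arrow
    is hit by appending it to a path that ends at its start. *)
Lemma P_obj_supported T t : sources T = [set t] ->
  supported (P_obj T) (sub_vert T) (sub_arr T).
Proof.
move=> Tt.
have toT v : v \in sub_vert T -> exists p : P_vert T, pend (val p) = v.
  move/(reach_source acQ Tt)/connect_walk => [s [sT ws sv]].
  have ts : t \in sources T by rewrite Tt set11.
  have [p [p1 p2]] := P_vertP ts sT ws.
  by exists p; rewrite /pend p1 p2.
split=> x; apply/codomP/idP => [[y ->] | xT]; rewrite ?ffunE ?P_arr_in //.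
- by case/andP: (valP y) => /path_in_end.
- by have [p pv] := toT x xT; exists p; rewrite ffunE.
have [p pv] := toT _ (proj1 (andP (sub_arrP xT))).
have /andP[/and3P[p1 p2 p3] p1s] := valP p.
have [q [q1 q2]] : exists q : P_vert T, (val q).1 = (val p).1 /\
    (val q).2 = rcons (val p).2 x :> seq (arr Q).
  apply: P_vertP => //; first by rewrite all_rcons p2 andbT.
  by rewrite -cats1 walk_cat p3 /= andbT; apply/eqP; rewrite -pv.
have pxq : is_append (val p) x (val q) by rewrite /is_append pv q1 q2 !eqxx.
by exists (exist _ (p, x, q) pxq); rewrite ffunE.
Qed.

Lemma P_obj_out_tree T t : sources T = [set t] -> out_tree (P_obj T) t.
Proof.
move=> Tt; have ts : t \in sources T by rewrite Tt set11.
have [r [r1 r2]] := P_vertP (s := [::]) ts isT isT.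
exists r; split.
- by rewrite ffunE /pend r1 r2.
- move=> x; rewrite ffunE => xt; move: ts; rewrite inE => /andP[_ /forall_inP].
  by move/(_ _ (P_arr_in x)); rewrite xt eqxx.
- move=> x y xy; have [_ x1 x2] := P_arrP x; have [_ y1 y2] := P_arrP y.
  move: x1 x2 y1 y2; rewrite [P_tgt x]xy => -> -> e1 /rcons_inj[e2 ea].
  by apply: P_arr_ext => //; apply: P_vert_ext.
- move=> x y xy; rewrite !ffunE => ab; apply: P_arr_ext => //.
  have [_ x1 x2] := P_arrP x; have [_ y1 y2] := P_arrP y.
  by apply: P_vert_ext; rewrite ?x1 ?x2 ?y1 ?y2 [P_src x]xy // ab.
(* Generation from the root: induction on the length of the path, removing its last arrow. *)
move=> K Kr KS p; have [n] := ubnP (size (val p).2).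
elim: n p => // n IH p sp.
have /andP[/and3P[_ pT pw] ps] := valP p.
move pE: ((val p).2 : seq (arr Q)) sp pT pw => s0; case/lastP: s0 pE => [|s a] pE sp pT pw.
  suff -> : p = r by [].
  apply: P_vert_ext; rewrite ?r1 ?r2 //.
  by apply/set1P; rewrite -Tt.
move: pT pw; rewrite all_rcons -cats1 walk_cat /= andbT => /andP[_ sT] /andP[sw /eqP sa].
have [q [q1 q2]] := P_vertP ps sT sw.
have qap : is_append (val q) a (val p) by rewrite /is_append /pend q1 q2 sa pE !eqxx.
apply: (KS (exist _ (q, a, p) qap)); apply: IH.
by rewrite /P_src /= q2; move: sp; rewrite size_rcons.
Qed.

End ProjectiveObjects.

(** * I-type objects as reversed out-trees *)

Section InjectiveObjects.
Variable Q : quiver.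
Hypothesis acQ : acyclic Q.
Implicit Types S T : subquiver Q.

Lemma reach_sink T u v : sinks T = [set u] -> v \in sub_vert T ->
  connect (step (sub_arr T)) v u.
Proof.
move=> Tu vT.
have := reach_source (acyclic_op acQ) (T := sub_op T) Tu vT.
rewrite (_ : connect _ u v = connect [rel x y | step (sub_arr T) y x] u v).
  by rewrite connect_rev.
by apply: eq_connect => x y; apply: eq_existsb => a; congr andb; apply: andbC.
Qed.

Lemma I_vertP T v s : v \in sub_vert T -> all [in sub_arr T] s -> walk v s ->
  last v (map (@tgt Q) s) \in sinks T ->
  exists p : I_vert T, (val p).1 = v /\ (val p).2 = s :> seq (arr Q).
Proof.
move=> vT sT ws us; have [p [pT p1 p2]] := path_inP acQ vT sT ws.
have pP : path_in T p && (pend p \in sinks T) by rewrite pT /pend p1 p2.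
by exists (exist _ p pP).
Qed.

Lemma I_arrP T (x : I_arr T) :
  [/\ tgt (val x).1.2 = (val (I_tgt x)).1,
      (val (I_src x)).1 = src (val x).1.2 &
      (val (I_src x)).2 = (val x).1.2 :: (val (I_tgt x)).2 :> seq (arr Q)].
Proof. by case: x => [[[p a] q] H]; case/and3P: (H) => /eqP e1 /eqP e2 /eqP e3. Qed.

Lemma I_vert_ext T (p q : I_vert T) : (val p).1 = (val q).1 ->
  (val p).2 = (val q).2 :> seq (arr Q) -> p = q.
Proof. by move=> e1 e2; apply/val_inj/qpath_ext. Qed.

Lemma I_arr_ext T (x y : I_arr T) : I_src x = I_src y -> (val x).1.2 = (val y).1.2 ->
  I_tgt x = I_tgt y -> x = y.
Proof. by move=> e1 e2 e3; apply/val_inj/triple_ext. Qed.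

Lemma I_arr_in T (x : I_arr T) : (val x).1.2 \in sub_arr T.
Proof.
have [_ _ q2] := I_arrP x; have := valP (I_src x).
by case/andP => /and3P[_ + _] _; rewrite q2 => /andP[].
Qed.

Lemma I_obj_supported T u : sinks T = [set u] ->
  supported (I_obj T) (sub_vert T) (sub_arr T).
Proof.
move=> Tu.
have toT v : v \in sub_vert T -> exists p : I_vert T, (val p).1 = v.
  move=> vT; have /connect_walk[s [sT ws sv]] := reach_sink Tu vT.
  have [|p [p1 _]] := I_vertP vT sT ws; first by rewrite sv Tu set11.
  by exists p.
split=> x; apply/codomP/idP => [[y ->] | xT]; rewrite ?ffunE ?I_arr_in //.
- by case/andP: (valP y) => /and3P[].
- by have [p pv] := toT x xT; exists p; rewrite ffunE.
have [sT tT] := andP (sub_arrP xT).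
have [q qv] := toT _ tT.
have /andP[/and3P[q1 q2 q3] qs] := valP q.
have [||||p [p1 p2]] := @I_vertP T (src x) (x :: (val q).2) => //=.
- by apply/andP.
- by rewrite eqxx -qv.
- by rewrite -qv.
have pxq : is_prepend (val p) x (val q) by rewrite /is_prepend qv p1 p2 !eqxx.
by exists (exist _ (p, x, q) pxq); rewrite ffunE.
Qed.

(** The root is the trivial path at the sink. Paths keep their original order and grow at the front,
    so the tree axioms are checked directly, with first arrows in the role that last arrows play for
    P-type objects. *)
Lemma I_obj_in_tree T u : sinks T = [set u] -> out_tree (over_op (I_obj T)) u.
Proof.
move=> Tu; have us : u \in sinks T by rewrite Tu set11.
have uT : u \in sub_vert T by move: us; rewrite inE => /andP[].
have [r [r1 r2]] := I_vertP (s := [::]) uT isT isT us.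
exists r; split.
- by rewrite ffunE.
- move=> x; rewrite ffunE => xu; move: us; rewrite inE => /andP[_ /forall_inP].
  by move/(_ _ (I_arr_in x)); rewrite -xu eqxx.
- move=> x y xy; have [_ x1 x2] := I_arrP x; have [_ y1 y2] := I_arrP y.
  move: x2 y2; rewrite [I_src x]xy => -> -[ea e2].
  have [x3 _ _] := I_arrP x; have [y3 _ _] := I_arrP y.
  by apply: I_arr_ext => //; apply: I_vert_ext; rewrite // -x3 ea.
- move=> x y xy; rewrite !ffunE => ab; apply: I_arr_ext => //.
  have [_ x1 x2] := I_arrP x; have [_ y1 y2] := I_arrP y.
  by apply: I_vert_ext; rewrite ?x1 ?y1 ?x2 ?y2 ab // [I_tgt x]xy.
move=> K Kr KS p; have [n] := ubnP (size (val p).2).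
elim: n p => // n IH p sp.
have /andP[/and3P[p1 pT pw] ps] := valP p; move: ps; rewrite /pend.
move pE: ((val p).2 : seq (arr Q)) sp pT pw => [|a s] sp /= pT pw ps.
  suff -> : p = r by [].
  apply: I_vert_ext; rewrite ?r1 ?r2 //.
  by apply/set1P; rewrite -Tu.
have [aT sT] := andP pT; have [/eqP aE sw] := andP pw.
have [_ tT] := andP (sub_arrP aT).
have [q [q1 q2]] := I_vertP tT sT sw ps.
have paq : is_prepend (val p) a (val q) by rewrite /is_prepend pE q1 q2 aE !eqxx.
apply: (KS (exist _ (p, a, q) paq)); apply: IH.
by rewrite /= /I_tgt /= q2.
Qed.

End InjectiveObjects.

(** * When an object coincides with the E-type object of its subquiver *)

Section TreeCriteria.
Variable Q : quiver.
Hypothesis acQ : acyclic Q.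
Implicit Types (R S T : subquiver Q) (k : pie_kind) (x y : pie_label Q).

Lemma out_tree_tgt_inj (X : quiver_over Q) t : out_tree X t -> injective (@tgt X).
Proof. by case=> r []. Qed.

(** Arrows of [X] with a common source are sent to arrows of [Y] with a common source, hence to one
    arrow. They then have the same image in Q and are equal by unique lifting, so [X] is a line. *)
Lemma out_tree_hom_mono (X Y : quiver_over Q) t f : out_tree X t ->
  injective (@src Y) -> f \in hom_over X Y -> mono X.
Proof.
move=> tX sY /hom_overP[fs _ _ f1]; apply: (out_tree_src_inj_mono acQ tX) => a b ab.
have [r [_ _ _ starX _]] := tX; apply: starX => //.
by rewrite -!f1; congr ((str Y).2 _); apply: sY; rewrite !fs ab.
Qed.

(** Arrows of [S] with a common target are sent to arrows of [Y] with a common target, hence to one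
    arrow, and the structure maps recover the arrow of Q. *)
Lemma hom_E_tgt_inj S (Y : quiver_over Q) f : injective (@tgt Y) ->
  f \in hom_over (E_obj S) Y -> {in sub_arr S &, injective (@tgt Q)}.
Proof.
move=> tY /hom_overP[_ ft _ f1] a b aS bS ab.
pose u : E_arr S := exist _ a aS; pose v : E_arr S := exist _ b bS.
have uv : f.2 u = f.2 v.
  by apply: tY; rewrite !ft; congr (f.1 _); apply: val_inj.
by have := f1 v; rewrite -uv f1 !ffunE.
Qed.

Lemma pie_definedE S : nonempty_connected S -> pie_defined (KE, S).
Proof. by rewrite /pie_defined andbT. Qed.

Lemma pie_supported x : pie_defined x ->
  supported (pie_obj x) (sub_vert x.2) (sub_arr x.2).
Proof.
case: x => [[] T] /andP[_] /=.
- by case/cards1P => t; apply: P_obj_supported.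
- by case/cards1P => t; apply: I_obj_supported.
- by move=> _; apply: E_obj_supported.
Qed.

Lemma hom_included x y f : pie_defined x -> pie_defined y ->
  f \in hom_over (pie_obj x) (pie_obj y) -> sub_included x.2 y.2.
Proof. by move=> /pie_supported sx /pie_supported sy /hom_support; apply. Qed.

Lemma pie_eq_E k S : pie_defined (k, S) -> mono (pie_obj (k, S)) ->
  pie_eq (k, S) (KE, S).
Proof.
move=> dS mS; rewrite /pie_eq dS; have /andP[cS _] := dS.
rewrite (pie_definedE cS) /=.
exact: isomorphic_mono mS (E_obj_mono S) (pie_supported dS) (E_obj_supported S).
Qed.

(** If each vertex of [S] receives at most one arrow, paths from the unique source are determined by
    their ends, so the structure map of the P-type object is injective. *)
Lemma tgt_inj_P_eq_E S : nonempty_connected S ->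
  {in sub_arr S &, injective (@tgt Q)} -> pie_eq (KP, S) (KE, S).
Proof.
move=> cS tS; have uS := tgt_inj_unique_source acQ cS tS.
have dS : pie_defined (KP, S) by rewrite /pie_defined cS.
apply: (pie_eq_E dS); have [t St] := cards1P uS.
apply: (out_tree_mono (P_obj_out_tree acQ St)) => a b.
by rewrite !ffunE; apply: tS; apply: P_arr_in.
Qed.

Lemma src_inj_I_eq_E S : nonempty_connected S ->
  {in sub_arr S &, injective (@src Q)} -> pie_eq (KI, S) (KE, S).
Proof.
move=> cS tS.
have cS' : nonempty_connected (sub_op S) by rewrite nonempty_connected_op.
have uS : unique_sink S := tgt_inj_unique_source (acyclic_op acQ) cS' tS.
have dS : pie_defined (KI, S) by rewrite /pie_defined cS.
apply: (pie_eq_E dS); have [t St] := cards1P uS.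
apply: (out_tree_mono (I_obj_in_tree acQ St)) => a b.
by rewrite !ffunE; apply: tS; apply: I_arr_in.
Qed.

Lemma hom_E_P S T f : nonempty_connected S -> unique_source T ->
  f \in hom_over (E_obj S) (P_obj T) -> pie_eq (KP, S) (KE, S).
Proof.
move=> cS /cards1P[t Tt] fH; apply: tgt_inj_P_eq_E => //.
exact: hom_E_tgt_inj (out_tree_tgt_inj (P_obj_out_tree acQ Tt)) fH.
Qed.

End TreeCriteria.

(** * Counting morphisms between objects of PIE *)

Section HomCounts.
Variable Q : quiver.
Hypothesis acQ : acyclic Q.
Implicit Types (R S T : subquiver Q) (k : pie_kind) (x y : pie_label Q).

Lemma I_src_inj T : unique_sink T -> injective (@src (I_obj T)).
Proof. by case/cards1P => u Tu; apply: out_tree_tgt_inj (I_obj_in_tree acQ Tu). Qed.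

Lemma P_tgt_inj T : unique_source T -> injective (@tgt (P_obj T)).
Proof. by case/cards1P => u Tu; apply: out_tree_tgt_inj (P_obj_out_tree acQ Tu). Qed.

Lemma hom_E_src_inj S (Y : quiver_over Q) f : injective (@src Y) ->
  f \in hom_over (E_obj S) Y -> {in sub_arr S &, injective (@src Q)}.
Proof.
move=> sY /hom_overP[fs _ _ f1] a b aS bS ab.
pose u : E_arr S := exist _ a aS; pose v : E_arr S := exist _ b bS.
have uv : f.2 u = f.2 v.
  by apply: sY; rewrite !fs; congr (f.1 _); apply: val_inj.
by have := f1 v; rewrite -uv f1 !ffunE.
Qed.

Lemma hom_E_I S T f : nonempty_connected S -> unique_sink T ->
  f \in hom_over (E_obj S) (I_obj T) -> pie_eq (KI, S) (KE, S).
Proof.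
move=> cS uT fH; apply: (src_inj_I_eq_E acQ) => //.
exact: hom_E_src_inj (I_src_inj uT) fH.
Qed.

Lemma pie_eq_hom x y : pie_eq x y -> exists f, f \in hom_over (pie_obj y) (pie_obj x).
Proof. by case/and3P => _ _ /exists_inP[g _ /exists_inP[f fH _]]; exists f. Qed.

(** In an I-type object each vertex emits at most one arrow, so the P-type object of [S] is a line
    and coincides with the E-type one. Composing with this isomorphism gives a morphism from the
    E-type object, which forces the I-type coincidence too. *)
Lemma hom_P_I S T f : pie_defined (KP, S) -> unique_sink T ->
  f \in hom_over (P_obj S) (I_obj T) ->
  pie_eq (KI, S) (KE, S) /\ pie_eq (KP, S) (KE, S).
Proof.
move=> dS uT fH; have /andP[cS uS] := dS.
have /cards1P[t St] : unique_source S := uS.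
have PE : pie_eq (KP, S) (KE, S).
  apply: (pie_eq_E acQ dS).
  exact: (out_tree_hom_mono acQ (P_obj_out_tree acQ St) (I_src_inj uT) fH).
have [g gH] := pie_eq_hom PE.
by split; [exact (hom_E_I cS uT (qcomp_hom_over fH gH)) | exact: PE].
Qed.

Lemma hom_I_P S T f : pie_defined (KI, S) -> unique_source T ->
  f \in hom_over (I_obj S) (P_obj T) ->
  pie_eq (KP, S) (KE, S) /\ pie_eq (KI, S) (KE, S).
Proof.
move=> dS uT fH; have /andP[cS uS] := dS.
have /cards1P[t St] : unique_sink S := uS.
have fH' := hom_over_op fH.
have IE : pie_eq (KI, S) (KE, S).
  have mI : mono (over_op (I_obj S)).
    exact (out_tree_hom_mono (acyclic_op acQ) (I_obj_in_tree acQ St)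
             (P_tgt_inj uT : injective (@src (over_op (P_obj T)))) fH').
  by apply: (pie_eq_E acQ dS); split; [apply: mI.1 | apply: mI.2].
have [g gH] := pie_eq_hom IE.
by split; [exact (hom_E_P acQ cS uT (qcomp_hom_over fH gH)) | exact: IE].
Qed.

(** Collects all morphisms that change the kind and do not end in an E-type object, in a form
    symmetric in P and I. For [k = KE] the second conclusion is reflexivity. *)
Lemma hom_kind_neq k k' S T : pie_defined (k, S) -> pie_defined (k', T) ->
  k != k' -> k' != KE -> hom_over (pie_obj (k, S)) (pie_obj (k', T)) != set0 ->
  pie_eq (k', S) (KE, S) /\ pie_eq (k, S) (KE, S).
Proof.
move=> dS /andP[_ dT] kk' k'E /set0Pn H.
have cS : nonempty_connected S by case/andP: dS.
have EE : pie_eq (KE, S) (KE, S).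
  by rewrite /pie_eq (pie_definedE cS) isomorphic_refl.
case: k k' kk' k'E dS dT H => [] [] // _ _ dS dT [f fH].
- exact (hom_P_I dS dT fH).
- exact (hom_I_P dS dT fH).
- by split; [exact (hom_E_P acQ cS dT fH) | exact: EE].
- by split; [exact (hom_E_I cS dT fH) | exact: EE].
Qed.

(** The coincidence gives a morphism from the E-type object, which makes targets (for P) or sources
    (for I) injective on the arrows of [T]; either excludes parallel arrows. *)
Lemma pie_eq_E_parallel k T a b : k != KE -> pie_eq (k, T) (KE, T) ->
  a \in sub_arr T -> b \in sub_arr T -> src a = src b -> tgt a = tgt b -> a = b.
Proof.
move=> kE kT aT bT s_ab t_ab; have [f fH] := pie_eq_hom kT.
have dT : pie_defined (k, T) by case/and3P: kT.
case: k kE {kT} f fH dT => // _ f fH /andP[_ dT].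
  exact: (hom_E_tgt_inj (P_tgt_inj dT) fH).
exact: (hom_E_src_inj (I_src_inj dT) fH).
Qed.

(** Paths of [S] are paths of [T], and equality of the source sets keeps their starting vertices
    admissible. *)
Lemma P_hom_exists S T : sub_included S T -> sources S = sources T ->
  exists f, f \in hom_over (P_obj S) (P_obj T).
Proof.
case/andP => /subsetP Vs /subsetP As ST.
have inT (p : P_vert S) : path_in T (val p) && ((val p).1 \in sources T).
  have /andP[/and3P[p1 /allP p2 p3] p4] := valP p.
  by rewrite /path_in Vs // p3 -ST p4 !andbT; apply/allP => a /p2 /As.
pose f0 p : P_vert T := exist _ (val p) (inT p).
pose f1 (x : P_arr S) : P_arr T := exist _ (f0 (P_src x), (val x).1.2, f0 (P_tgt x)) (valP x).
exists ([ffun p => f0 p], [ffun x => f1 x] : {ffun P_arr S -> P_arr T}).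
rewrite inE; apply/andP; split.
  by apply/forallP => x; rewrite !ffunE !eqxx.
by apply/eqP/qmap_ext => p; rewrite !ffunE.
Qed.

Lemma I_hom_exists S T : sub_included S T -> sinks S = sinks T ->
  exists f, f \in hom_over (I_obj S) (I_obj T).
Proof.
case/andP => /subsetP Vs /subsetP As ST.
have inT (p : I_vert S) : path_in T (val p) && (pend (val p) \in sinks T).
  have /andP[/and3P[p1 /allP p2 p3] p4] := valP p.
  by rewrite /path_in Vs // p3 -ST p4 !andbT; apply/allP => a /p2 /As.
pose f0 p : I_vert T := exist _ (val p) (inT p).
pose f1 (x : I_arr S) : I_arr T := exist _ (f0 (I_src x), (val x).1.2, f0 (I_tgt x)) (valP x).
exists ([ffun p => f0 p], [ffun x => f1 x] : {ffun I_arr S -> I_arr T}).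
rewrite inE; apply/andP; split.
  by apply/forallP => x; rewrite !ffunE !eqxx.
by apply/eqP/qmap_ext => p; rewrite !ffunE.
Qed.

Lemma card_hom_P S T : unique_source T -> sub_included S T ->
  sources S = sources T -> #|hom_over (P_obj S) (P_obj T)| = 1.
Proof.
move=> /cards1P[t Tt] ST so; have [f fH] := P_hom_exists ST so.
have St := Tt; rewrite -so in St.
suff -> : hom_over (P_obj S) (P_obj T) = [set f] by rewrite cards1.
apply/setP => g; rewrite [RHS]inE; apply/idP/eqP => [gH | -> //].
exact: out_tree_hom_uniq (P_obj_out_tree acQ St) (P_obj_out_tree acQ Tt) gH fH.
Qed.

Lemma card_hom_I S T : unique_sink T -> sub_included S T ->
  sinks S = sinks T -> #|hom_over (I_obj S) (I_obj T)| = 1.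
Proof.
move=> /cards1P[t Tt] ST so; have [f fH] := I_hom_exists ST so.
have St := Tt; rewrite -so in St.
suff -> : hom_over (I_obj S) (I_obj T) = [set f] by rewrite cards1.
apply/setP => g; rewrite [RHS]inE; apply/idP/eqP => [gH | -> //].
exact (out_tree_hom_uniq (I_obj_in_tree acQ St) (I_obj_in_tree acQ Tt)
         (hom_over_op gH) (hom_over_op fH)).
Qed.

Lemma card_hom_same k S T : pie_defined (k, T) ->
  sub_included S T -> sources S = sources T -> sinks S = sinks T ->
  #|hom_over (pie_obj (k, S)) (pie_obj (k, T))| = 1.
Proof.
case: k => /andP[_ uT] ST so si.
- exact (card_hom_P uT ST so).
- exact (card_hom_I uT ST si).
have /andP[V A] := ST.
exact (card_hom_mono (E_obj_mono T) (E_obj_supported S) (E_obj_supported T) V A).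
Qed.

Lemma card_hom_E x T : pie_defined x -> sub_included x.2 T ->
  #|hom_over (pie_obj x) (E_obj T)| = 1.
Proof.
move=> dx /andP[V A].
exact: card_hom_mono (E_obj_mono T) (pie_supported acQ dx) (E_obj_supported T) V A.
Qed.

Lemma no_antiparallel (a b : arr Q) : src a = tgt b -> tgt a = src b -> False.
Proof.
move=> e1 e2; have := acyclic_connect acQ setT a.
by rewrite e1 e2 connect1 // stepE.
Qed.

End HomCounts.

(** * Subquivers with the same skeleton *)

Section Skeleton.
Variable Q : quiver.
Implicit Types R S T : subquiver Q.

Lemma sub_included_trans S R T :
  sub_included S R -> sub_included R T -> sub_included S T.
Proof.
case/andP => V1 A1 /andP[V2 A2].
by rewrite /sub_included (subset_trans V1 V2) (subset_trans A1 A2).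
Qed.

Lemma sub_included_refl T : sub_included T T.
Proof. by rewrite /sub_included !subxx. Qed.

Lemma sub_included_anti S T : sub_included S T -> sub_included T S -> S = T.
Proof.
move=> /andP[V1 A1] /andP[V2 A2]; apply: val_inj; change (sval S = sval T).
rewrite [sval S]surjective_pairing [sval T]surjective_pairing.
by congr (_, _); apply/eqP; rewrite eqEsubset; apply/andP.
Qed.

Lemma adjacent_sub S T v w : sub_included S T -> adjacent S v w -> adjacent T v w.
Proof.
case/andP => _ /subsetP AS /exists_inP[a aS avw].
by apply/exists_inP; exists a; rewrite ?AS.
Qed.

Variables S T : subquiver Q.
Hypotheses (cS : nonempty_connected S) (cT : nonempty_connected T).
Hypotheses (ST : sub_included S T) (skel : same_skeleton S T).

(** A vertex of [T] is joined to some vertex of [S] by edges of [T]. These are also edges of [S],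
    and the last one puts the vertex into [S]. *)
Lemma same_skeleton_vert : sub_vert S = sub_vert T.
Proof.
have /andP[VS _] := ST; apply/eqP; rewrite eqEsubset VS; apply/subsetP => v vT.
have /andP[/set0Pn[s sS] _] := cS.
have sv : connect (adjacent S) s v.
  rewrite (eq_connect skel).
  have /andP[_ /forall_inP conT] := cT.
  by have /forall_inP := conT s (subsetP VS _ sS); apply.
case: (connect_last sv) => [<- // | [z _ /exists_inP[a aS]]].
have /andP[s_a t_a] := sub_arrP aS.
by case/orP => /andP[/eqP e1 /eqP e2]; [rewrite -e2 | rewrite -e1].
Qed.

(** The skeleton forgets orientation, but acyclicity rules out an arrow of [S] running in the
    opposite direction. *)
Lemma same_skeleton_parallel a : acyclic Q -> a \in sub_arr T ->
  exists b, [/\ b \in sub_arr S, src b = src a & tgt b = tgt a].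
Proof.
move=> acQ aT; have : adjacent S (src a) (tgt a).
  by rewrite skel; apply/exists_inP; exists a; rewrite ?eqxx.
case/exists_inP => b bS /orP[] /andP[/eqP e1 /eqP e2]; first by exists b.
by case: (no_antiparallel acQ e1 e2).
Qed.

Lemma same_skeleton_sources : acyclic Q -> sources S = sources T.
Proof.
move=> acQ; apply/setP => v; rewrite !inE same_skeleton_vert; congr andb.
have /andP[_ /subsetP AS] := ST.
apply/forall_inP/forall_inP => vP a aX; last by apply: vP; apply: AS.
have [b [bS _ <-]] := same_skeleton_parallel acQ aX.
exact: vP.
Qed.

Lemma same_skeleton_sinks : acyclic Q -> sinks S = sinks T.
Proof.
move=> acQ; apply/setP => v; rewrite !inE same_skeleton_vert; congr andb.
have /andP[_ /subsetP AS] := ST.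
apply/forall_inP/forall_inP => vP a aX; last by apply: vP; apply: AS.
have [b [bS <- _]] := same_skeleton_parallel acQ aX.
exact: vP.
Qed.

(** An arrow of [T] is parallel to one of [S]; since a degenerate [T] has no parallel arrows, the
    two are equal. Hence only the bottom of an interval can be degenerate. *)
Lemma same_skeleton_pie_eq k : acyclic Q -> k != KE ->
  pie_eq (k, T) (KE, T) -> S = T.
Proof.
move=> acQ kE kT; apply: sub_included_anti => //.
rewrite /sub_included same_skeleton_vert subxx; apply/subsetP => a aT.
have [b [bS e1 e2]] := same_skeleton_parallel acQ aT.
have /andP[_ /subsetP AS] := ST.
by rewrite -(pie_eq_E_parallel acQ kE kT (AS _ bS) aT e1 e2).
Qed.

Lemma same_skeleton_defined k : acyclic Q -> pie_defined (k, S) = pie_defined (k, T).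
Proof.
move=> acQ; rewrite /pie_defined /= cS cT /= /unique_source /unique_sink.
by rewrite same_skeleton_sources // same_skeleton_sinks.
Qed.

End Skeleton.

Lemma same_skeleton_between (Q : quiver) (S R T : subquiver Q) :
  nonempty_connected S -> nonempty_connected T ->
  sub_included S T -> same_skeleton S T ->
  sub_included S R -> sub_included R T ->
  [/\ nonempty_connected R, same_skeleton S R & same_skeleton R T].
Proof.
move=> cS cT ST skel SR RT.
have sSR : same_skeleton S R.
  move=> v w; apply/idP/idP; first exact: adjacent_sub.
  by rewrite skel; apply: adjacent_sub.
have sRT : same_skeleton R T by move=> v w; rewrite -sSR skel.
split=> //; have VR : sub_vert R = sub_vert S.
  apply/eqP; rewrite eqEsubset andbC; have /andP[-> _] := SR; have /andP[RV _] := RT.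
  by rewrite (same_skeleton_vert cS cT ST skel) RV.
move: cS; rewrite /nonempty_connected VR => /andP[-> /= /forall_inP H].
apply/forall_inP => v vS; apply/forall_inP => w wS.
by rewrite -(eq_connect sSR); have /forall_inP := H v vS; apply.
Qed.

(** * Alternating sums over subsets, and invertibility of unitriangular integer matrices *)

Local Open Scope ring_scope.

Lemma signed_subset_sum (I : finType) (D : {set I}) :
  \sum_(J : {set I} | J \subset D) (-1) ^+ #|J| = (D == set0)%:R :> int.
Proof.
(* Expanding the product of the factors [F i + 1] yields the signed sum; subsets not contained in
   [D] contribute a factor 0, and any element of [D] makes the product vanish. *)
pose F i : int := if i \in D then -1 else 0.
transitivity (\prod_i (F i + 1)).
  rewrite bigA_distr [RHS](bigID (fun J : {set I} => J \subset D)) /=.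
  rewrite [X in _ + X]big1 ?addr0 => [|J /subsetPn[i iJ iD]].
    apply: eq_bigr => J /subsetP JD; rewrite -big_mkcond /= -prodr_const.
    by apply: eq_bigr => i /JD iD; rewrite /F iD.
  by rewrite (bigD1 i) //= iJ /F (negPf iD) mul0r.
have [D0 | [i iD]] := set_0Vmem D.
  by rewrite D0 eqxx big1 // => i _; rewrite /F D0 inE add0r.
rewrite (bigD1 i) //= /F iD addNr mul0r.
by case: eqP => // D0; rewrite D0 inE in iD.
Qed.

(** A permutation with nonzero product never decreases the weight [f], and strictly increases it at
    each moved index. The total weight is invariant under permutation, so only the identity
    contributes and the determinant is 1. *)
Lemma unitriangular_unitmx n (M : 'M[int]_n) (f : 'I_n -> nat) :
  (forall i, M i i = 1) ->
  (forall i j, i != j -> M i j != 0 -> (f i < f j)%N) ->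
  M \in unitmx.
Proof.
move=> M1 Mf; rewrite unitmxE; suff -> : \det M = 1 by apply: unitr1.
rewrite /determinant (bigD1 (1%g : 'S_n)) //= odd_perm1 expr0 mul1r.
rewrite big1 => [|i _]; last by rewrite perm1 M1.
rewrite big1 ?addr0 // => s s1; apply/eqP; rewrite mulf_eq0; apply/orP; right.
apply: contraR s1 => /prodf_neq0 Ms; apply/eqP/permP => i; rewrite perm1.
apply/eqP; apply: contraT => si.
have le_f j : (f j <= f (s j))%N.
  have [-> // | nj] := eqVneq (s j) j.
  by apply/ltnW/Mf; [rewrite eq_sym | apply: Ms].
suff : (\sum_j f j < \sum_j f (s j))%N.
  by rewrite [X in (X < _)%N](reindex_inj (@perm_inj _ s)) ltnn.
rewrite (bigD1 i) //= [X in (_ < X)%N](bigD1 i) //= -addSn.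
by apply: leq_add; [apply: Mf; [rewrite eq_sym | apply: Ms] | apply: leq_sum].
Qed.

(** * Isomorphism classes, invertibility of the hom matrix and supports of Möbius values *)

Section Classes.
Variable Q : quiver.
Hypothesis acQ : acyclic Q.
Implicit Types (R S T : subquiver Q) (k : pie_kind) (x y : pie_label Q).
Implicit Types c d z : pie0 Q.

Definition pie_support c : subquiver Q := (val (repr c)).2.

Lemma pie_classP c : exists x (hx : pie_defined x), c = pie_class hx.
Proof.
exists (val (repr c)), (valP (repr c)); rewrite /pie_class -[LHS]reprK.
by congr (\pi _); apply: val_inj.
Qed.

Lemma repr_class x (hx : pie_defined x) :
  isomorphic (pie_obj (val (repr (pie_class hx)))) (pie_obj x).
Proof. by have /eqmodP : repr (pie_class hx) = exist _ x hx %[mod pie0 Q] by rewrite reprK. Qed.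

Lemma num_hom_class x y (hx : pie_defined x) (hy : pie_defined y) :
  num_hom (pie_class hx) (pie_class hy) = #|hom_over (pie_obj x) (pie_obj y)|.
Proof. exact: card_hom_isomorphic (repr_class hx) (repr_class hy). Qed.

Lemma support_class x (hx : pie_defined x) : pie_support (pie_class hx) = x.2.
Proof.
have [V A] := supported_isomorphic (repr_class hx)
  (pie_supported acQ (valP (repr (pie_class hx)))) (pie_supported acQ hx).
by apply: sub_included_anti; rewrite /sub_included /pie_support V A !subxx.
Qed.

Lemma num_hom_support c d : num_hom c d != 0%N -> sub_included (pie_support c) (pie_support d).
Proof.
rewrite cards_eq0 => /set0Pn[f].
exact: hom_included (valP (repr c)) (valP (repr d)).
Qed.

Lemma class_eqE x y (hx : pie_defined x) (hy : pie_defined y) :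
  x = y -> pie_class hx = pie_class hy.
Proof. by move=> xy; subst y; congr (\pi _); apply: val_inj. Qed.

Lemma num_homxx c : num_hom c c = 1%N.
Proof.
have [[k T] [hx ->]] := pie_classP c; rewrite num_hom_class.
by apply: card_hom_same => //; apply: sub_included_refl.
Qed.

(** Lists the possible targets of a morphism: an E-type object, one of the same kind, or one of
    another kind when both kinds degenerate at [S]. The row computations use it to find all nonzero
    terms. *)
Lemma num_hom_cases k S (hS : pie_defined (k, S)) z :
  num_hom (pie_class hS) z != 0%N ->
  exists k' (hz : pie_defined (k', pie_support z)), z = pie_class hz /\
    [\/ k' = KE, k' = k |
        [/\ k' != KE, pie_eq (k', S) (KE, S) & pie_eq (k, S) (KE, S)]].
Proof.
have [[k' T] [hz ->]] := pie_classP z; rewrite num_hom_class.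
have zT := support_class hz => H.
have hz' : pie_defined (k', pie_support (pie_class hz)) by rewrite zT.
exists k', hz'; split; first by apply: class_eqE; rewrite zT.
have [k'E | nE] := eqVneq k' KE; first by constructor 1.
have [k'k | nk] := eqVneq k k'; first by constructor 2.
constructor 3; have S0 : hom_over (pie_obj (k, S)) (pie_obj (k', T)) != set0 by rewrite -cards_eq0.
by have [] := hom_kind_neq acQ hS hz nk nE S0.
Qed.

Definition isE c : bool := isomorphic (pie_obj (val (repr c))) (E_obj (pie_support c)).

Lemma isE_class k T (h : pie_defined (k, T)) : isE (pie_class h) = pie_eq (k, T) (KE, T).
Proof.
have cT : nonempty_connected T := proj1 (andP h).
rewrite /isE support_class /pie_eq h (pie_definedE cT) /=.
have Hi := repr_class h; apply/idP/idP => H; last exact: isomorphic_trans Hi H.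
by rewrite isomorphic_sym in Hi; apply: isomorphic_trans Hi H.
Qed.

(** On one subquiver, the only morphisms between distinct objects go from a P- or I-type object to
    the E-type one. *)
Lemma num_hom_same_support c d : c != d -> num_hom c d != 0%N -> pie_support c = pie_support d ->
  isE d && ~~ isE c.
Proof.
have [[k T] [hx ->]] := pie_classP c => cd cd0 T_d.
have [k' [hz [dE H]]] := num_hom_cases cd0.
have dT : pie_support d = T by rewrite -T_d support_class.
move: hz dE; rewrite dT => hz dE.
have cT : nonempty_connected T := proj1 (andP hx).
have k'E : k' = KE.
  case: H => // [k'k | [_ e1 e2]].
    by case/eqP: cd; rewrite dE; apply: class_eqE; rewrite k'k.
  case/eqP: cd; rewrite dE; apply/eqP.
  have := e1; rewrite (pie_eqE hz (pie_definedE cT)) => /eqP ->.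
  by rewrite -pie_eqE.
subst k'; rewrite dE !isE_class.
rewrite {1}/pie_eq (pie_definedE cT) isomorphic_refl /=.
by apply: contra cd; rewrite dE -pie_eqE.
Qed.

(** Doubling the size of the support leaves room for a unit that places the E-type object above the
    other objects on the same subquiver. *)
Definition rank c : nat := (#|sub_vert (pie_support c)| + #|sub_arr (pie_support c)|).*2 + isE c.

Lemma rank_lt c d : c != d -> num_hom c d != 0%N -> (rank c < rank d)%N.
Proof.
move=> cd cd0; have /andP[V A] := num_hom_support cd0.
have [T_d | nT] := eqVneq (pie_support c) (pie_support d).
  have /andP[Ed /negPf Ec] := num_hom_same_support cd cd0 T_d.
  by rewrite /rank T_d Ec Ed addn0 addn1.
have lt : (#|sub_vert (pie_support c)| + #|sub_arr (pie_support c)| <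
           #|sub_vert (pie_support d)| + #|sub_arr (pie_support d)|)%N.
  rewrite ltn_neqAle leq_add ?subset_leq_card // andbT.
  apply: contra nT => /eqP e; apply/eqP/sub_included_anti; first exact: num_hom_support.
  have lV := subset_leq_card V; have lA := subset_leq_card A.
  have eV : #|sub_vert (pie_support c)| = #|sub_vert (pie_support d)|.
    apply/eqP; rewrite eqn_leq lV /= -(leq_add2r #|sub_arr (pie_support d)|) -e.
    by rewrite leq_add2l.
  have eA : #|sub_arr (pie_support c)| = #|sub_arr (pie_support d)|.
    by move/eqP: e; rewrite eV eqn_add2l => /eqP.
  have /eqP EV : sub_vert (pie_support c) == sub_vert (pie_support d) by rewrite eqEcard V eV leqnn.
  have /eqP EA : sub_arr (pie_support c) == sub_arr (pie_support d) by rewrite eqEcard A eA leqnn.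
  by rewrite /sub_included EV EA !subxx.
rewrite /rank; apply: leq_trans (leq_addr _ _); rewrite -addnS.
apply: leq_trans (_ : (#|sub_vert (pie_support c)| + #|sub_arr (pie_support c)|).+1.*2 <= _)%N.
  by rewrite doubleS -addn2 leq_add2l; case: (isE c).
by rewrite leq_double.
Qed.

Lemma hom_mx_unit : hom_mx Q \in unitmx.
Proof.
apply: (@unitriangular_unitmx _ _ (fun i => rank (enum_val i))) => [i | i j ij].
  by rewrite mxE num_homxx.
rewrite mxE => h; apply: rank_lt => //.
by apply: contra ij => /eqP /enum_val_inj ->.
Qed.

Lemma mobius_sum c d : \sum_z (num_hom c z)%:Z * mobius z d = (c == d)%:R.
Proof.
have /matrixP/(_ (enum_rank c) (enum_rank d)) := mulmxV hom_mx_unit.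
rewrite !mxE (reindex (@enum_rank (pie0 Q))) /=; last exact/onW_bij/enum_rank_bij.
rewrite (inj_eq enum_rank_inj) => <-; apply: eq_bigr => z _.
by rewrite [hom_mx Q _ _]mxE !enum_rankK.
Qed.

(** Descending induction on [rank c]. If the support of [c] is not contained in that of [d], the row
    relation expresses the value through objects of larger rank that receive a morphism from [c];
    their supports contain that of [c], so their values vanish. *)
Lemma mobius_support c d : mobius c d != 0 -> sub_included (pie_support c) (pie_support d).
Proof.
(* The subtracted rank is below this constant: the doubled size is at most twice the number of
   vertices and arrows of Q, and the last unit adds at most 1. *)
apply: contraR; have [n] := ubnP ((#|vert Q| + #|arr Q|).*2.+2 - rank c).
elim: n c => // n IH c; rewrite ltnS => cn ncd.
have cd : c != d by apply: contra ncd => /eqP ->; apply: sub_included_refl.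
have := mobius_sum c d; rewrite (negPf cd) (bigD1 c) //= num_homxx mul1r.
rewrite big1 => [|z zc]; first by rewrite addr0 => ->.
have [-> | cz] := eqVneq (num_hom c z) 0%N; first by rewrite mul0r.
have lt : (rank c < rank z)%N by rewrite eq_sym in zc; exact: rank_lt zc cz.
have zb : (rank z < (#|vert Q| + #|arr Q|).*2.+2)%N.
  rewrite ltnS -[X in (_ <= X)%N]addn1; apply: leq_add; last by case: (isE z).
  by rewrite leq_double; apply: leq_add; apply: max_card.
apply/eqP; rewrite mulf_eq0; apply/orP; right; apply: IH.
  by apply: leq_trans cn; apply: ltn_sub2l => //; apply: leq_trans lt _; apply: ltnW.
by apply: contra ncd; apply: sub_included_trans; apply: num_hom_support.
Qed.

(** The row is grouped by support. Outside the interval either the number of morphisms or the Möbius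
    value is zero. *)
Lemma mobius_sum_interval c d :
  \sum_(R | sub_included (pie_support c) R && sub_included R (pie_support d))
     \sum_(z | pie_support z == R) (num_hom c z)%:Z * mobius z d = (c == d)%:R.
Proof.
pose P R := sub_included (pie_support c) R && sub_included R (pie_support d).
rewrite -mobius_sum [RHS](bigID (fun z => P (pie_support z))) /=.
rewrite [X in _ = _ + X]big1 => [|z].
  rewrite addr0 (partition_big pie_support P) //=.
  apply: eq_bigr => R RP; apply: eq_bigl => z.
  by case: eqP => [-> | _]; rewrite ?andbF ?andbT //; apply/esym.
apply: contraNeq; rewrite mulf_eq0 negb_or => /andP[h1 h2].
by rewrite /P num_hom_support // mobius_support.
Qed.

End Classes.

(** * Boolean inversion on intervals of subquivers *)

Section SubquiverInterval.
Variable Q : quiver.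
Implicit Types R S T : subquiver Q.

Lemma delete_arrows_subproof T (B : {set arr Q}) :
  is_subquiver (sub_vert T, sub_arr T :\: B).
Proof. by apply/forall_inP => a /setDP[/sub_arrP]. Qed.

Definition delete_arrows T B : subquiver Q :=
  exist (fun U => is_subquiver U) _ (delete_arrows_subproof T B).

(** Taking the set of arrows deleted from [T] identifies the interval with the subsets of the arrows
    of [T] outside [S]. *)
Lemma signed_interval_sum S T : sub_vert S = sub_vert T -> sub_included S T ->
  \sum_(R | sub_included S R && sub_included R T) (-1) ^+ #|sub_arr T :\: sub_arr R|
    = (S == T)%:R :> int.
Proof.
move=> VST ST; have /andP[_ AST] := ST.
have VD B : sub_vert (delete_arrows T B) = sub_vert T by [].
have AD B : sub_arr (delete_arrows T B) = sub_arr T :\: B by [].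
rewrite (reindex_onto (delete_arrows T) (fun R => sub_arr T :\: sub_arr R)); last first.
  move=> R /andP[/andP[SV SA] /andP[TV TA]]; apply: sub_included_anti.
    rewrite /sub_included VD AD -VST SV /=.
    by apply/subsetP => a; rewrite !inE negb_and negbK => /andP[/orP[] // /negPf ->].
  rewrite /sub_included VD AD TV /=.
  by apply/subsetP => a aR; rewrite !inE aR /= (subsetP TA).
have hK (B : {set arr Q}) : B \subset sub_arr T -> sub_arr T :\: (sub_arr T :\: B) = B.
  move=> BT; apply/setP => a; rewrite !inE negb_and negbK.
  by have [/(subsetP BT) -> | _] := boolP (a \in B); rewrite ?orbT //= andbC; case: (a \in _).
transitivity (\sum_(B : {set arr Q} | B \subset sub_arr T :\: sub_arr S) (-1) ^+ #|B| : int).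
  apply: eq_big => [B | B /andP[_ /eqP ->] //].
  rewrite /sub_included VD AD -VST subxx subsetDl /= andbT.
  apply/andP/idP => [[SB /eqP <-] | BD].
    by rewrite setDS.
  have BT : B \subset sub_arr T by apply: subset_trans BD (subsetDl _ _).
  rewrite hK ?eqxx //; split=> //.
  apply/subsetP => a aS; rewrite inE (subsetP AST) // andbT.
  by apply/negP => /(subsetP BD); rewrite inE aS.
rewrite signed_subset_sum setD_eq0; congr (_%:R); congr nat_of_bool.
apply/idP/eqP => [TS | ->]; last exact: subxx.
by apply: sub_included_anti; rewrite // /sub_included VST subxx.
Qed.

(** Inversion in the Boolean lattice, by induction on the number of arrows missing from [S]. The
    constant [c] stands for the value of the right-hand side at [T]. *)
Lemma interval_inversion S T (f : subquiver Q -> int) (c : int) :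
  sub_vert S = sub_vert T -> sub_included S T ->
  (forall R, sub_included S R -> sub_included R T ->
    \sum_(R' | sub_included R R' && sub_included R' T) f R' = (R == T)%:R * c) ->
  f S = (-1) ^+ #|sub_arr T :\: sub_arr S| * c.
Proof.
have [n] := ubnP #|sub_arr T :\: sub_arr S|.
elim: n S => // n IH S; rewrite ltnS => Sn VST ST fP.
have P_S : sub_included S S && sub_included S T by rewrite sub_included_refl.
have := fP _ (sub_included_refl S) ST.
(* With the Kronecker symbol replaced by the signed sum, both sides split off [R = S]; the remaining
   terms agree by induction. *)
rewrite -(signed_interval_sum VST ST) (bigD1 S) //= [in RHS](bigD1 S) //=.
rewrite mulrDl big_distrl /= => /(canRL (addrK _)) ->; rewrite -addrA.
rewrite -[RHS]addr0; congr (_ + _); apply/eqP; rewrite subr_eq0; apply/eqP/esym.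
apply: eq_bigr => R /andP[/andP[SR RT] RS].
have /andP[VSR ASR] := SR; have /andP[VRT ART] := RT.
have VR : sub_vert R = sub_vert T by apply/eqP; rewrite eqEsubset VRT -VST.
apply: IH => // [|R' RR' R'T]; last by apply: fP => //; apply: sub_included_trans RR'.
apply: leq_trans Sn; apply: proper_card; rewrite properE setDS //=.
apply: contra RS => /subsetP DS; apply/eqP/esym/sub_included_anti => //.
rewrite /sub_included VR -VST subxx; apply/subsetP => a aR; apply: contraT => aS.
by have := DS a; rewrite !inE aS aR (subsetP ART) // => /(_ isT).
Qed.

End SubquiverInterval.

(* The class of x, or the junk value d when x is not defined. *)
Definition class_or (Q : quiver) (d : pie0 Q) (x : pie_label Q) : pie0 Q :=
  if insub x is Some u then \pi_(pie0 Q) (u : pie_valid Q) else d.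

(* Locked because comparing the deltas of two labels by conversion evaluates pie_defined. *)
HB.lock Definition class_delta (Q : quiver) (d : pie0 Q) (x : pie_label Q) : int :=
  (class_or d x == d)%:R.

(** * Rows of the inverse relation over an interval of subquivers *)

Section Rows.
Variable Q : quiver.
Hypothesis acQ : acyclic Q.
Implicit Types (R S T : subquiver Q) (k : pie_kind) (x y : pie_label Q).
Implicit Types c d z : pie0 Q.

Lemma class_orE d x (hx : pie_defined x) : class_or d x = pie_class hx.
Proof. by rewrite /class_or insubT. Qed.

Lemma support_class_or d x : pie_defined x -> pie_support (class_or d x) = x.2.
Proof. by move=> hx; rewrite class_orE support_class. Qed.

Lemma class_or_eq d x y : pie_defined x -> pie_defined y ->
  (class_or d x == class_or d y) = pie_eq x y.
Proof. by move=> hx hy; rewrite !class_orE pie_eqE. Qed.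

(** Contribution of a single subquiver [R] to a row: the objects listed by [ks] are distinct, each
    receives exactly one morphism from [c], and no other object on [R] receives any. *)
Lemma mobius_fiber c d R (ks : seq pie_kind) : uniq ks ->
  {in ks, forall k, pie_defined (k, R)} ->
  {in ks, forall k, num_hom c (class_or d (k, R)) = 1%N} ->
  {in ks &, forall k k', pie_eq (k, R) (k', R) -> k = k'} ->
  (forall z, pie_support z = R -> num_hom c z != 0%N ->
     exists2 k, k \in ks & z = class_or d (k, R)) ->
  \sum_(z | pie_support z == R) (num_hom c z)%:Z * mobius z d =
    \sum_(k <- ks) mobius (class_or d (k, R)) d.
Proof.
move=> uks dks hks iks zks; pose l := [seq class_or d (k, R) | k <- ks].
have ul : uniq l.
  rewrite map_inj_in_uniq // => k k' kk kk' /eqP.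
  by rewrite class_or_eq ?dks //; apply: iks.
rewrite (bigID [in l]) /= [X in _ + X]big1 ?addr0 => [|z /andP[/eqP zR zl]].
  rewrite -(big_map _ xpredT (fun z => mobius z d)) -/l big_uniq //=.
  apply: eq_big => [z | z /andP[_ /mapP[k kk ->]]]; last by rewrite hks // mul1r.
  case: (boolP (z \in l)) => [/mapP[k kk ->] | _]; last by rewrite andbF.
  by rewrite support_class_or ?dks // eqxx.
have [-> | nz] := eqVneq (num_hom c z) 0%N; first by rewrite mul0r.
have [k kk zE] := zks z zR nz.
by case/negP: zl; rewrite zE; apply: map_f.
Qed.

Definition spans S T : Prop :=
  [/\ nonempty_connected S, nonempty_connected T, sub_included S T & same_skeleton S T].

Lemma spans_between S R T : spans S T -> sub_included S R -> sub_included R T ->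
  spans S R /\ spans R T.
Proof.
move=> [cS cT ST skel] SR RT.
by have [cR s1 s2] := same_skeleton_between cS cT ST skel SR RT.
Qed.

Lemma spans_defined S T k : spans S T -> pie_defined (k, S) = pie_defined (k, T).
Proof. by move=> [cS cT ST skel]; apply: same_skeleton_defined. Qed.

Lemma spans_pie_eq S T k : spans S T -> k != KE -> pie_eq (k, T) (KE, T) -> S = T.
Proof. by move=> [cS cT ST skel]; apply: same_skeleton_pie_eq. Qed.

Lemma spans_nondegenerate S T k : spans S T -> k != KE ->
  ~~ pie_eq (k, S) (KE, S) -> ~~ pie_eq (k, T) (KE, T).
Proof.
by move=> sp kE; apply: contra => kT; have ST := spans_pie_eq sp kE kT; subst T.
Qed.

Lemma num_hom_same_kind d S T k (hS : pie_defined (k, S)) : spans S T ->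
  num_hom (pie_class hS) (class_or d (k, T)) = 1%N.
Proof.
move=> sp; have hT : pie_defined (k, T) by rewrite -(spans_defined k sp).
have [cS cT ST skel] := sp.
rewrite class_orE num_hom_class; apply: card_hom_same => //.
  exact: same_skeleton_sources.
exact: same_skeleton_sinks.
Qed.

Lemma num_hom_E d S T k (hS : pie_defined (k, S)) : spans S T ->
  num_hom (pie_class hS) (class_or d (KE, T)) = 1%N.
Proof.
move=> [cS cT ST skel].
by rewrite class_orE ?pie_definedE // => hT; rewrite num_hom_class; apply: card_hom_E.
Qed.

Lemma mobius_row k S (hS : pie_defined (k, S)) d (f : subquiver Q -> int) :
  (forall R, sub_included S R -> sub_included R (pie_support d) ->
     \sum_(z | pie_support z == R) (num_hom (pie_class hS) z)%:Z * mobius z d = f R) ->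
  \sum_(R | sub_included S R && sub_included R (pie_support d)) f R = (pie_class hS == d)%:R.
Proof.
move=> fE; rewrite -(mobius_sum_interval acQ) support_class //.
by apply: eq_bigr => R /andP[SR RT]; rewrite fE.
Qed.

Lemma pie_eq_sym x y : pie_eq x y = pie_eq y x.
Proof. by rewrite /pie_eq isomorphic_sym andbCA. Qed.

(** Nondegeneracy passes from [S] to every [R] above it, so each [R] contributes two distinct
    objects, of kinds E and [k], and no third kind is reached. *)
Lemma mobius_row_PI k S d : k != KE -> pie_defined (k, S) ->
  ~~ pie_eq (k, S) (KE, S) -> spans S (pie_support d) ->
  \sum_(R | sub_included S R && sub_included R (pie_support d))
     (mobius (class_or d (KE, R)) d + mobius (class_or d (k, R)) d) =
  class_delta d (k, S).
Proof.
move=> kE hS ndS sp; rewrite class_delta.unlock class_orE.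
apply: mobius_row => R SR RT; have [sSR sRT] := spans_between sp SR RT.
have [_ cR _ _] := sSR.
have hR : pie_defined (k, R) by rewrite -(spans_defined k sSR).
have nd := spans_nondegenerate sSR kE ndS.
rewrite (@mobius_fiber _ _ _ [:: KE; k]) ?big_cons ?big_nil ?addr0 //=.
- by rewrite inE eq_sym kE.
- by move=> k'; rewrite !inE => /orP[] /eqP -> //; apply: pie_definedE.
- by move=> k'; rewrite !inE => /orP[] /eqP ->; [apply: num_hom_E | apply: num_hom_same_kind].
- move=> k1 k2; rewrite !inE => /orP[] /eqP -> /orP[] /eqP -> //.
    by rewrite pie_eq_sym (negPf nd).
  by rewrite (negPf nd).
move=> z zR /(num_hom_cases acQ)[k' [hz [zE H]]]; exists k'.
  by rewrite !inE; case: H => [-> | -> | [_ _]]; rewrite ?eqxx ?orbT // (negPf ndS).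
by rewrite zE -(class_orE d) zR.
Qed.

Lemma mobius_row_E (ks : seq pie_kind) S d : uniq ks -> KE \notin ks ->
  (forall k, k != KE -> (k \in ks) = pie_eq (k, S) (KE, S)) ->
  spans S (pie_support d) ->
  \sum_(R | sub_included S R && sub_included R (pie_support d))
     (if R == S then mobius (class_or d (KE, S)) d
      else \sum_(k <- KE :: ks) mobius (class_or d (k, R)) d) =
  class_delta d (KE, S).
Proof.
move=> uks nks ksP sp; have [cS cT _ _] := sp.
have hS := pie_definedE cS; rewrite class_delta.unlock (class_orE _ hS).
have ksE k : k \in ks -> k != KE.
  by move=> kk; apply: contra nks => /eqP <-.
apply: mobius_row => R SR RT; have [sSR sRT] := spans_between sp SR RT.
have [_ cR _ _] := sSR; have hR := pie_definedE cR.
have [RS | nRS] := eqVneq R S.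
  subst R; rewrite (bigD1 (pie_class hS)) /=; last by rewrite support_class // eqxx.
  rewrite num_homxx // mul1r big1 ?addr0 // => z /andP[/eqP zS zn].
  have [-> | nz] := eqVneq (num_hom (pie_class hS) z) 0%N; first by rewrite mul0r.
  have e : pie_support (pie_class hS) = pie_support z by rewrite support_class.
  rewrite eq_sym in zn; have := num_hom_same_support acQ zn nz e.
  by rewrite isE_class // /pie_eq hS isomorphic_refl andbF.
have nd k : k != KE -> ~~ pie_eq (k, R) (KE, R).
  move=> kE; apply: contra nRS => kR; apply/eqP/esym; exact: spans_pie_eq sSR kE kR.
have eqS k : k \in KE :: ks -> pie_eq (k, S) (KE, S).
  rewrite inE => /predU1P[-> | kk]; first by rewrite /pie_eq hS isomorphic_refl.
  by rewrite -ksP // ksE.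
have dS k : k \in KE :: ks -> pie_defined (k, S) by move/eqS => /and3P[].
have dR k : k \in KE :: ks -> pie_defined (k, R).
  by move=> /dS; rewrite (spans_defined k sSR).
apply: mobius_fiber => //=.
- by rewrite nks.
- move=> k kk; have hk := dS k kk.
  (* The domain is relabelled with the kind of the codomain, so that morphisms of equal kind are
     counted. *)
  have -> : pie_class hS = pie_class hk by apply/eqP; rewrite -pie_eqE pie_eq_sym eqS.
  exact: num_hom_same_kind.
- move=> k k' kk kk' e; apply/eqP; apply: contraT => nkk'.
  have [k'E | k'nE] := eqVneq k' KE; first by subst k'; rewrite (negPf (nd k nkk')) in e.
  have /and3P[h1 h2 /exists_inP[f fH _]] := e.
  have [|H1 _] := hom_kind_neq acQ h1 h2 nkk' k'nE; first by apply/set0Pn; exists f.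
  by case/negP: (nd k' k'nE).
move=> z zR /(num_hom_cases acQ)[k' [hz [zE H]]]; exists k'.
  rewrite inE; case: H => [-> | -> | [k'E k'S _]]; rewrite ?eqxx //.
  by rewrite ksP // k'S orbT.
by rewrite zE -(class_orE d) zR.
Qed.

End Rows.

(** * Möbius values from the bottom to the top of an interval *)

Section Values.
Variable Q : quiver.
Hypothesis acQ : acyclic Q.
Implicit Types (R S T : subquiver Q) (k : pie_kind) (x y : pie_label Q).
Implicit Types c d z : pie0 Q.

Local Notation mu d k R := (mobius (class_or d (k, R)) d).
Local Notation delta d k R := (class_delta d (k, R)).
Local Notation sgn S T := ((-1) ^+ #|sub_arr T :\: sub_arr S| : int).

(** Puts the right-hand side of a row into the shape that [interval_inversion] requires. *)
Lemma delta_support k R d : pie_defined (k, R) ->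
  delta d k R = (R == pie_support d)%:R * delta d k (pie_support d).
Proof.
move=> hR; rewrite class_delta.unlock.
have [-> | RT] := eqVneq R (pie_support d); first by rewrite mul1r.
rewrite mul0r; case: eqP => // e; case/eqP: RT.
by rewrite -[in RHS]e support_class_or.
Qed.

Lemma spans_vert S T : spans S T -> sub_vert S = sub_vert T.
Proof. by move=> [cS cT ST skel]; apply: same_skeleton_vert. Qed.

Lemma sum_mobius_E S d : spans S (pie_support d) ->
  (forall k, k != KE -> ~~ pie_eq (k, S) (KE, S)) ->
  \sum_(R | sub_included S R && sub_included R (pie_support d)) mu d KE R = delta d KE S.
Proof.
move=> sp nd; rewrite -(mobius_row_E acQ (ks := [::]) isT isT _ sp) => [|k /nd /negPf //].
apply: eq_bigr => R _; rewrite big_cons big_nil addr0.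
by case: (R =P S) => [-> |].
Qed.

Lemma mobius_E S d : spans S (pie_support d) ->
  (forall k, k != KE -> ~~ pie_eq (k, S) (KE, S)) ->
  mu d KE S = sgn S (pie_support d) * delta d KE (pie_support d).
Proof.
move=> sp nd; have [_ _ ST _] := sp.
apply: (interval_inversion (f := fun R => mu d KE R) (spans_vert sp) ST) => R SR RT.
have [sSR sRT] := spans_between sp SR RT; have [cR _ _ _] := sRT.
rewrite -(delta_support d (pie_definedE cR)); apply: sum_mobius_E sRT _ => k kE.
exact: spans_nondegenerate sSR kE (nd k kE).
Qed.

Lemma mobius_E_PI k S d : spans S (pie_support d) -> k != KE -> pie_defined (k, S) ->
  ~~ pie_eq (k, S) (KE, S) ->
  mu d KE S + mu d k S = sgn S (pie_support d) * delta d k (pie_support d).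
Proof.
move=> sp kE hS nd; have [_ _ ST _] := sp.
apply: (interval_inversion (f := fun R => mu d KE R + mu d k R) (spans_vert sp) ST) => R SR RT.
have [sSR sRT] := spans_between sp SR RT.
have hR : pie_defined (k, R) by rewrite -(spans_defined acQ k sSR).
rewrite -(delta_support d hR).
exact: mobius_row_PI kE hR (spans_nondegenerate acQ sSR kE nd) sRT.
Qed.

(** Inversion is applied to the function that sums over all kinds in [KE :: ks] above [S] but keeps
    a single term at [S]. Rows starting at a larger [R] never meet the modified term. *)
Lemma mobius_degenerate (ks : seq pie_kind) S d (c : int) : uniq ks -> KE \notin ks ->
  (forall k, k != KE -> (k \in ks) = pie_eq (k, S) (KE, S)) ->
  spans S (pie_support d) ->
  (forall R, spans S R -> spans R (pie_support d) -> R != S ->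
     \sum_(R' | sub_included R R' && sub_included R' (pie_support d))
        \sum_(k <- KE :: ks) mu d k R' = (R == pie_support d)%:R * c) ->
  delta d KE S = (S == pie_support d)%:R * c ->
  mu d KE S = sgn S (pie_support d) * c.
Proof.
move=> uks nks ksP sp rowR rowS; have [_ _ ST _] := sp.
pose f R := if R == S then mu d KE S else \sum_(k <- KE :: ks) mu d k R.
rewrite -[LHS](_ : f S = _); last by rewrite /f eqxx.
apply: (interval_inversion (spans_vert sp) ST) => R SR RT.
have [sSR sRT] := spans_between sp SR RT.
have [-> | RS] := eqVneq R S; first by rewrite -rowS -(mobius_row_E acQ uks nks ksP sp).
rewrite -rowR //; apply: eq_bigr => R' /andP[RR' _]; rewrite /f.
case: eqP => // R'S; case/eqP: RS; apply: sub_included_anti => //.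
by rewrite -R'S.
Qed.

Lemma degenerate_class_or d k S : pie_eq (k, S) (KE, S) -> delta d k S = delta d KE S.
Proof.
move=> kS; have /and3P[h1 h2 _] := kS.
rewrite class_delta.unlock; suff -> : class_or d (k, S) = class_or d (KE, S) by [].
by apply/eqP; rewrite class_or_eq.
Qed.

Lemma spans_nondegenerate_lt S R k : spans S R -> R != S -> k != KE ->
  ~~ pie_eq (k, R) (KE, R).
Proof.
move=> sp RS kE; apply: contra RS => kR.
by rewrite eq_sym; apply/eqP; apply: (spans_pie_eq acQ sp kE kR).
Qed.

(** Above [S] the summand consists of the kinds E and [p], which is the row of the nondegenerate
    object of kind [p]. *)
Lemma mobius_degenerate1 p i S d : (forall k, k != KE -> (k == p) || (k == i)) ->
  p != KE -> i != p -> spans S (pie_support d) ->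
  pie_eq (p, S) (KE, S) -> ~~ pie_eq (i, S) (KE, S) ->
  mu d KE S = sgn S (pie_support d) * delta d p (pie_support d).
Proof.
move=> kinds pE ip sp pS iS; have hS : pie_defined (p, S) by case/and3P: pS.
apply: (mobius_degenerate (ks := [:: p])) => //.
- by rewrite inE eq_sym.
- move=> k /kinds /orP[] /eqP ->; rewrite inE ?eqxx ?pS //.
  by rewrite (negPf ip) (negPf iS).
- move=> R sSR sRT RS; have hR : pie_defined (p, R) by rewrite -(spans_defined acQ p sSR).
  rewrite -(delta_support d hR) -(mobius_row_PI acQ pE hR (spans_nondegenerate_lt sSR RS pE) sRT).
  by apply: eq_bigr => R' _; rewrite !big_cons big_nil addr0.
- by rewrite -(degenerate_class_or d pS); apply: delta_support hS.
Qed.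

(** Above [S] the sum over three kinds is the row of kind [p] plus the row of kind [i] minus the row
    of kind E, which would otherwise be counted twice. At [S] the three symbols coincide, so the
    same combination reduces to one of them. *)
Lemma mobius_degenerate2 p i S d : (forall k, k != KE -> (k == p) || (k == i)) ->
  p != KE -> i != KE -> i != p -> spans S (pie_support d) ->
  pie_eq (p, S) (KE, S) -> pie_eq (i, S) (KE, S) ->
  mu d KE S = sgn S (pie_support d) *
    (delta d p (pie_support d) + delta d i (pie_support d) - delta d KE (pie_support d)).
Proof.
move=> kinds pE iE ip sp pS iS.
have hpS : pie_defined (p, S) by case/and3P: pS.
have hiS : pie_defined (i, S) by case/and3P: iS.
have hES : pie_defined (KE, S) by case/and3P: iS.
apply: (mobius_degenerate (ks := [:: p; i])) => //.
- by rewrite /= inE eq_sym ip.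
- by rewrite !inE negb_or eq_sym pE eq_sym.
- by move=> k /kinds /orP[] /eqP ->; rewrite !inE ?eqxx ?orbT ?pS ?iS.
- move=> R sSR sRT RS; have nd k := spans_nondegenerate_lt sSR RS (k := k).
  have hpR : pie_defined (p, R) by rewrite -(spans_defined acQ p sSR).
  have hiR : pie_defined (i, R) by rewrite -(spans_defined acQ i sSR).
  have hER : pie_defined (KE, R) by rewrite -(spans_defined acQ KE sSR).
  rewrite mulrBr mulrDr -(delta_support d hpR) -(delta_support d hiR).
  rewrite -(delta_support d hER) -(sum_mobius_E sRT nd).
  rewrite -(mobius_row_PI acQ pE hpR (nd p pE) sRT) -(mobius_row_PI acQ iE hiR (nd i iE) sRT).
  rewrite -sumrN -!big_split /=; apply: eq_bigr => R' _.
  rewrite !big_cons big_nil addr0.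
  move: (mobius _ _) (mobius _ _) (mobius _ _) => v u e.
  by rewrite (addrC e v) !addrA addrK.
- have ep := delta_support d hpS; have ei := delta_support d hiS; have eE := delta_support d hES.
  rewrite mulrBr mulrDr -ep -ei -eE (degenerate_class_or d pS) (degenerate_class_or d iS).
  by rewrite addrK.
Qed.

End Values.

(* The pair (p, i) is (P, I) for the displayed formulas and (I, P) for their
   duals. When A is empty, T = S, so that mu(E_S, E_T) = 1; hence the premise
   A != set0 on the two formulas that give another value. *)
Theorem proposition30 (Q : quiver) (hQ : acyclic Q) (S T : subquiver Q)
    (hS : nonempty_connected S) (hT : nonempty_connected T)
    (hST : sub_included S T) (hskel : same_skeleton S T)
    (p i : pie_kind) (hpi : (p = KP /\ i = KI) \/ (p = KI /\ i = KP)) :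
  let A := sub_arr T :\: sub_arr S in
  [/\ ~~ pie_eq (p, S) (KE, S) -> ~~ pie_eq (KE, S) (i, S) ->
        [/\ mobius_eq (KE, S) (p, T) 0,
            mobius_eq (KE, S) (KE, T) ((-1) ^+ #|A|),
            mobius_eq (p, S) (p, T) ((-1) ^+ #|A|),
            mobius_eq (p, S) (KE, T) ((-1) ^+ #|A|.+1) &
            mobius_eq (p, S) (i, T) 0],
      pie_eq (p, S) (KE, S) -> ~~ pie_eq (KE, S) (i, S) ->
        [/\ A != set0 -> mobius_eq (KE, S) (KE, T) 0,
            mobius_eq (KE, S) (p, T) ((-1) ^+ #|A|) &
            mobius_eq (KE, S) (i, T) 0] &
      pie_eq (p, S) (KE, S) -> pie_eq (KE, S) (i, S) ->
        (A != set0 -> mobius_eq (KE, S) (KE, T) ((-1) ^+ #|A|.+1)) /\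
        mobius_eq (KE, S) (p, T) ((-1) ^+ #|A|)].
Proof.
move=> A; have sp : spans S T by split.
have [pE iE ip] : [/\ p != KE, i != KE & i != p] by case: hpi => -[-> ->].
have kinds k : k != KE -> (k == p) || (k == i) by case: hpi k => -[-> ->] [].
have A0 : A != set0 -> T != S.
  by apply: contra => /eqP TS; rewrite /A TS setDv.
have deltaE k k' (h : pie_defined (k', T)) : pie_defined (k, T) ->
    class_delta (pie_class h) (k, T) = (pie_eq (k, T) (k', T))%:R.
  by move=> hk; rewrite class_delta.unlock class_orE -pie_eqE.
have self k : pie_defined (k, T) -> pie_eq (k, T) (k, T).
  by move=> h; rewrite /pie_eq h isomorphic_refl.
have hE := pie_definedE hT.
(* A coincidence of the P- and I-type objects on [T] would make both equal to the E-type one; this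
   excludes the unwanted Kronecker symbols below. *)
have pi_eq : pie_defined (p, T) -> pie_defined (i, T) -> pie_eq (p, T) (i, T) ->
    pie_eq (i, T) (KE, T).
  move=> hp hi /and3P[_ _ /exists_inP[f fH _]].
  have pi : p != i by rewrite eq_sym.
  have H0 : hom_over (pie_obj (p, T)) (pie_obj (i, T)) != set0 by apply/set0Pn; exists f.
  by have [] := hom_kind_neq hQ hp hi pi iE H0.
rewrite ![pie_eq (KE, S) (i, S)]pie_eq_sym.
split=> [ndp ndi | dp ndi | dp di].
- have nd k : k != KE -> ~~ pie_eq (k, S) (KE, S) by move/kinds/orP=> [] /eqP ->.
  have ndT k : k != KE -> pie_eq (k, T) (KE, T) = false.
    by move=> kE; exact: negPf (spans_nondegenerate hQ sp kE (nd k kE)).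
  have vE k (h : pie_defined (k, T)) (hx : pie_defined (KE, S)) :
      mobius (pie_class hx) (pie_class h) = (-1) ^+ #|A| * (pie_eq (KE, T) (k, T))%:R.
    have := @mobius_E Q hQ S (pie_class h).
    by rewrite support_class // class_orE deltaE // => ->.
  (* The row of kind [p] determines the sum of the values at E and [p]; subtracting the value at E
     leaves the one sought. *)
  have vp k (h : pie_defined (k, T)) (hx : pie_defined (p, S)) :
      mobius (pie_class hx) (pie_class h) =
        (-1) ^+ #|A| * (pie_eq (p, T) (k, T))%:R - (-1) ^+ #|A| * (pie_eq (KE, T) (k, T))%:R.
    have hp : pie_defined (p, T) by rewrite -(spans_defined hQ p sp).
    have := @mobius_E_PI Q hQ p S (pie_class h); rewrite support_class // deltaE //.
    rewrite (class_orE _ (pie_definedE hS)) (class_orE _ hx) (vE k h) => <- //.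
    by rewrite addrAC subrr add0r.
  split=> hx hy.
  + by rewrite vE pie_eq_sym ndT // mulr0.
  + by rewrite vE self // mulr1.
  + by rewrite vp self // pie_eq_sym ndT // mulr0 subr0 mulr1.
  + by rewrite vp self // ndT // mulr0 sub0r mulr1 exprS mulN1r.
  + have hp : pie_defined (p, T) by rewrite -(spans_defined hQ p sp).
    rewrite vp (pie_eq_sym (KE, T)) ndT // !mulr0 subr0.
    by rewrite (_ : pie_eq _ _ = false) ?mulr0 //; apply/negP => /(pi_eq hp hy); rewrite ndT.
- have hp : pie_defined (p, T).
    by rewrite -(spans_defined hQ p sp); case/and3P: dp.
  have v k (h : pie_defined (k, T)) (hx : pie_defined (KE, S)) :
      mobius (pie_class hx) (pie_class h) = (-1) ^+ #|A| * (pie_eq (p, T) (k, T))%:R.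
    have := @mobius_degenerate1 Q hQ p i S (pie_class h) kinds pE ip.
    by rewrite support_class // class_orE deltaE // => ->.
  split=> [TS | |] hx hy; last 2 first.
  + by rewrite v self // mulr1.
  (* A nonzero symbol would make the object of kind [i] on [T] degenerate, forcing [S = T] and
     contradicting [ndi]. *)
  + rewrite v (_ : pie_eq _ _ = false) ?mulr0 //; apply/negP => /(pi_eq hp hy) iT.
    by have ST := spans_pie_eq hQ sp iE iT; case/negP: ndi; rewrite ST.
  + by rewrite v (negPf (spans_nondegenerate_lt hQ sp (A0 TS) pE)) mulr0.
- have hp : pie_defined (p, T).
    by rewrite -(spans_defined hQ p sp); case/and3P: dp.
  have hi : pie_defined (i, T).
    by rewrite -(spans_defined hQ i sp); case/and3P: di.
  have v k (h : pie_defined (k, T)) (hx : pie_defined (KE, S)) :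
      mobius (pie_class hx) (pie_class h) = (-1) ^+ #|A| *
        ((pie_eq (p, T) (k, T))%:R + (pie_eq (i, T) (k, T))%:R - (pie_eq (KE, T) (k, T))%:R).
    have := @mobius_degenerate2 Q hQ p i S (pie_class h) kinds pE iE ip.
    by rewrite support_class // class_orE !deltaE // => ->.
  split=> [TS |] hx hy.
    have nd k (kE : k != KE) := negPf (spans_nondegenerate_lt hQ sp (A0 TS) kE).
    by rewrite v self // !nd // addr0 sub0r mulrN1 exprS mulN1r.
  (* The last two symbols cancel: for [T = S] they agree because the objects of kinds [i] and E
     coincide, and otherwise both are zero by nondegeneracy. *)
  rewrite v self //; suff -> : pie_eq (i, T) (p, T) = pie_eq (KE, T) (p, T).
    by rewrite addrK mulr1.
  have [TS | nTS] := eqVneq T S.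
    subst T; rewrite (pie_eqE hi hy) (pie_eqE hE hy).
    by move: di; rewrite (pie_eqE hi hE) => /eqP ->.
  have nd k (kE : k != KE) := negPf (spans_nondegenerate_lt hQ sp nTS kE).
  rewrite (pie_eq_sym (KE, T)) nd //; apply/negP; rewrite pie_eq_sym => /(pi_eq hp hi).
  by rewrite nd.
Qed.
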